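(* Let $L$ be a transitive permutation group of degree $2k$ with a system of imprimitivity consisting of two blocks $A$ and $B$. Let $L_\omega$ be a point-stabiliser and let $L_{(A)}$ be the pointwise stabiliser of $A$ in $L$. Let $\ell\ge1$ and $m\ge2$ be integers, let $\Gamma=\mathrm C(k,2\ell m,m-1)$ and let $uv$ be an arc of $\Gamma$. Then there exists a group $G\le\mathrm{Aut}(\Gamma)$ such that $(\Gamma,G)$ is locally-$L$ and $|G_{uv}|=|L_{(A)}|^{2m(\ell-1)}|L_\omega|^m$.
   Context: A pair $(\Gamma,G)$ with $G\le\mathrm{Aut}(\Gamma)$ is locally-$L$ if $G$ is transitive on the arcs (ordered pairs of adjacent vertices) of $\Gamma$ and the permutation group induced by the vertex-stabiliser $G_v$ on the neighbourhood $\Gamma(v)$ is permutation isomorphic to $L$. The graphs $\mathrm C(k,r,s)$ (for integers $r\ge3$, $1\le s\le r-1$, $k\ge1$) are defined as follows: $\mathrm C(k,r,1)$ has vertex-set $\mathbb Z_k\times\mathbb Z_r$, with $(u,i)$ adjacent to $(v,j)$ iff $i-j\in\{-1,1\}$. A path in $\mathrm C(k,r,1)$ is traversing if it contains at most one vertex of $\mathbb Z_k\times\{y\}$ for each $y\in\mathbb Z_r$. For $s\ge2$, $\mathrm C(k,r,s)$ has as vertices the traversing paths of length $s-1$ in $\mathrm C(k,r,1)$, two such paths being adjacent iff their union is a traversing path of length $s$ in $\mathrm C(k,r,1)$. *)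

(* Defs.v *)
From mathcomp Require Import all_boot all_fingroup all_algebra.

Set Implicit Arguments.
Unset Strict Implicit.
Unset Printing Implicit Defensive.

Record sgraph := SGraph {
  vertex :> finType;
  adj : rel vertex;
  adj_sym : symmetric adj;
  adj_irr : irreflexive adj
}.

Section Groups.
Local Open Scope group_scope.

Definition graph_aut (Gam : sgraph) : {set {perm Gam}} :=
  [set g : {perm Gam} | [forall x, forall y, adj (g x) (g y) == adj x y]].

Definition neighbourhood (Gam : sgraph) (v : Gam) : {set Gam} :=
  [set x | adj v x].

Definition arc_transitive (Gam : sgraph) (G : {group {perm Gam}}) : Prop :=
  forall x y x' y' : Gam, adj x y -> adj x' y' ->
    exists2 g, g \in G & (g x, g y) = (x', y').

Definition induced_perm_group (T : finType) (H : {group {perm T}})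
    (S : {set T}) : {set {perm {x : T | x \in S}}} :=
  actperm ('P^?)%act @* H.

Definition local_group (Gam : sgraph) (G : {group {perm Gam}}) (v : Gam) :=
  induced_perm_group 'C_G[v | 'P]%G (neighbourhood v).

Definition perm_isomorphic (T1 T2 : finType)
    (H : {group {perm T1}}) (K : {set {perm T2}}) : Prop :=
  exists (f : T1 -> T2) (psi : {morphism H >-> {perm T2}}),
    [/\ bijective f, isom H K psi &
        forall h x, h \in H -> f (h x) = psi h (f x)].

Definition locally (T : finType) (L : {group {perm T}})
    (Gam : sgraph) (G : {group {perm Gam}}) : Prop :=
  [/\ G \subset graph_aut Gam,
      arc_transitive G &
      forall v : Gam, perm_isomorphic L (local_group G v)].

(* Unlike primitive_action.imprimitivity_system, this admits blocks of size
   one, as needed for two blocks in degree 2. *)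
Definition block_system (T : finType) (L : {group {perm T}})
    (P : {set {set T}}) : bool :=
  partition P [set: T] && [acts L, on P | 'P^*].

End Groups.

(* A subgraph is given by its vertex set and its edge set, the edges being
   unordered pairs; a path is thus identified with its reversal. *)
Definition subgraph (T : finType) : finType := ({set T} * {set {set T}})%type.

Definition subgraphU (T : finType) (H K : subgraph T) : subgraph T :=
  (H.1 :|: K.1, H.2 :|: K.2).

Definition walk_subgraph (T : finType) (p : seq T) : subgraph T :=
  ([set:: p], [set:: [seq [set e.1; e.2] | e <- zip p (behead p)]]).

Definition is_path (Gam : sgraph) (n : nat) (H : subgraph Gam) : bool :=
  [exists p : n.+1.-tuple Gam,
     [&& uniq p, sorted (@adj Gam) p & H == walk_subgraph p]].

(* The first coordinate only serves as a set of k elements, so it is 'I_k, which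
   is right for every k. The second is 'Z_r, which is Z/rZ only if r >= 2. *)
Section BaseGraph.
Variables k r : nat.
Local Open Scope ring_scope.

Definition C1_vertex : finType := ('I_k * 'Z_r)%type.

Definition C1_adj : rel C1_vertex :=
  fun x y => (x.2 - y.2)%R \in [:: -1; 1].

Lemma C1_adj_sym : symmetric C1_adj.
Proof.
move=> x y; rewrite /C1_adj !inE -[y.2 - x.2]GRing.opprB.
by rewrite GRing.eqr_opp GRing.eqr_oppLR orbC.
Qed.

Lemma C1_adj_irr : irreflexive C1_adj.
Proof.
move=> x; rewrite /C1_adj GRing.subrr !inE.
by rewrite ![0 == _]eq_sym GRing.oppr_eq0 GRing.oner_eq0.
Qed.

Definition C1 : sgraph := SGraph C1_adj_sym C1_adj_irr.

End BaseGraph.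

Section TraversingPaths.
Variables k r : nat.

Definition traversing (H : subgraph (C1 k r)) : bool :=
  [forall y : 'Z_r, #|[set x : C1 k r in H.1 | x.2 == y]| <= 1].

Definition traversing_path (n : nat) (H : subgraph (C1 k r)) : bool :=
  is_path n H && traversing H.

Variable n : nat.

Definition trav_vertex : finType :=
  {H : subgraph (C1 k r) | traversing_path n H}.

Definition trav_adj : rel trav_vertex :=
  fun P Q => traversing_path n.+1 (subgraphU (val P) (val Q)).

Lemma trav_adj_sym : symmetric trav_adj.
Proof. by move=> P Q; rewrite /trav_adj /subgraphU setUC [_.2 :|: _]setUC. Qed.

Lemma is_path_card (Gam : sgraph) m (H : subgraph Gam) :
  is_path m H -> #|H.1| = m.+1.
Proof.
case/existsP=> p /and3P[Up _ /eqP->] /=.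
by rewrite cardsE (card_uniqP Up) size_tuple.
Qed.

Lemma trav_adj_irr : irreflexive trav_adj.
Proof.
move=> P; apply/negP; case/andP=> /is_path_card /=; rewrite setUid.
by case/andP: (valP P) => /is_path_card -> _ /eqP; rewrite eqSS ltn_eqF.
Qed.

Definition trav_graph : sgraph := SGraph trav_adj_sym trav_adj_irr.

End TraversingPaths.

(* The graph C(k,r,s), meaningful for r >= 3, 1 <= s <= r - 1 and k >= 1. The
   case s = 1 is separate because two single vertices carry no edge, so their
   union is never a path of length 1. *)
Definition Cgraph (k r s : nat) : sgraph :=
  if s is n.+2 then trav_graph k r n.+1 else C1 k r.

(* Main.v *)
Require Import Defs.
From mathcomp Require Import all_boot all_fingroup all_algebra zify.

(** Every vertex of C(k,r,s) is a segment: one point in each of s consecutive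
    columns of C(k,r,1). For s = m - 1 the neighbours of a segment starting in
    column i correspond to the points of the columns i - 1 and i - 1 + m. Each
    pair of columns c, c + m is therefore identified with Omega, a column
    carrying A or B according to the parity of c div m, which changes with
    c -> c + m because r = 2 l m. The group consists of the permutations of the
    points of C(k,r,1) that act on columns as elements of the dihedral group
    and on each pair of columns c, c + m as an element of L.

    A dihedral column map changes or preserves the parity uniformly on a
    residue class mod m, so elements of L may be prescribed independently on
    the m residue classes; this gives arc-transitivity and the local action L.
    An element fixing an arc fixes one point in each of m consecutive columns
    i, ..., i + m - 1 and preserves all columns. On each residue class it is
    determined by an element of a point-stabiliser of L (its action on the
    columns c and c + m with c in the range above) and, for each of the
    remaining 2 l - 2 columns, by an element of L fixing the other block
    pointwise; all choices occur. *)

Set Implicit Arguments.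
Unset Strict Implicit.
Unset Printing Implicit Defensive.

Import GRing.Theory.
Local Open Scope ring_scope.

(** * Segments *)

Section Segments.

Variables (k r : nat).
Hypothesis r_gt2 : (2 < r)%N.

Local Notation point := ('I_k * 'Z_r)%type.

Lemma natr_Zp_inj a b :
  (a < r)%N -> (b < r)%N -> a%:R = b%:R :> 'Z_r -> a = b.
Proof.
have r_gt1 := ltnW r_gt2.
by move=> a_lt b_lt /(congr1 val); rewrite /= !val_Zp_nat // !modn_small.
Qed.

(** The coordinates are a function on all of [nat], so that shifting or extending a segment needs no
    casts; only the values below [s] matter. *)
Definition seg (i : 'Z_r) (x : nat -> 'I_k) (s : nat) : {set point} :=
  [set (x (val t), i + (val t)%:R) | t : 'I_s].

Definition isseg (s : nat) (S : {set point}) : Prop :=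
  exists i x, S = seg i x s.

Lemma segP i x s a :
  reflect (exists2 t, (t < s)%N & a = (x t, i + t%:R)) (a \in seg i x s).
Proof.
apply: (iffP imsetP) => [[t _ ->]|[t lt_ts ->]]; first by exists t.
by exists (Ordinal lt_ts).
Qed.

Lemma mem_seg i x s t : (t < s)%N -> (x t, i + t%:R) \in seg i x s.
Proof. by move=> lt_ts; apply/segP; exists t. Qed.

Lemma eq_seg i x y s : (forall t, (t < s)%N -> x t = y t) ->
  seg i x s = seg i y s.
Proof. by move=> eq_xy; apply: eq_imset => t /=; rewrite eq_xy //=. Qed.

Lemma seg_column_inj i x s a b : (s <= r)%N ->
  a \in seg i x s -> b \in seg i x s -> a.2 = b.2 -> a = b.
Proof.
move=> le_sr /segP[t lt_t ->] /segP[u lt_u ->] /= /addrI eq_tu.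
by rewrite (natr_Zp_inj _ _ eq_tu) //; apply: leq_trans le_sr.
Qed.

(** The first point of the shorter segment has some offset [t1 <= s]. Its last point has offset
    [t1 + s - 1 < 2 s <= r], so nothing wraps around, and being at most [s] this forces
    [t1 <= 1]. *)
Lemma seg_sub i x j y s : (0 < s)%N -> (s.*2 <= r)%N ->
  seg j y s \subset seg i x s.+1 ->
  exists2 b : bool, j = i + b%:R & forall t, (t < s)%N -> y t = x (t + b)%N.
Proof.
move=> s_gt0 le_sr /subsetP sub; have r_gt1 := ltnW r_gt2.
have /segP[t1 lt_t1 /pair_equal_spec[_]] := sub _ (mem_seg j y s_gt0).
rewrite addr0 => def_j.
have get t : (t < s)%N ->
    exists2 t', (t' <= s)%N & y t = x t' /\ (t1 + t = t' %[mod r])%N.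
  move=> lt_ts; have /segP[t' lt_t' /pair_equal_spec[-> eq_t']] := sub _
    (mem_seg j y lt_ts).
  exists t' => //; split=> //; move: eq_t'.
  rewrite def_j -addrA -natrD => /addrI /(congr1 val).
  by rewrite /= !val_Zp_nat.
have t1_le1 : (t1 <= 1)%N.
  have /get[t' le_t' [_]] : (s.-1 < s)%N by lia.
  by rewrite !modn_small; lia.
exists (t1 == 1)%N; first by rewrite def_j; case: t1 t1_le1 {get def_j lt_t1}
  => [|[]].
move=> t lt_ts; have [t' le_t' [->]] := get t lt_ts.
by rewrite !modn_small; [move=> <- | lia | lia]; congr x; lia.
Qed.

Lemma seg_inj i x j y s : (0 < s)%N -> (s.*2 <= r)%N ->
  seg i x s = seg j y s -> i = j /\ forall t, (t < s)%N -> x t = y t.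
Proof.
move=> s_gt0 le_sr eq_ij; have r_gt1 := ltnW r_gt2.
have sub_S i' x' : seg i' x' s \subset seg i' x' s.+1.
  by apply/subsetP=> _ /segP[t lt_t ->]; rewrite mem_seg // ltnW.
have [|b def_i eq_xy] := @seg_sub j y i x s s_gt0 le_sr.
  by rewrite eq_ij.
have [|b' def_j _] := @seg_sub i x j y s s_gt0 le_sr.
  by rewrite -eq_ij.
(* The two offsets add up to zero modulo [r], while their sum is at most 2. *)
have b0 : b = false.
  move/eqP: def_j; rewrite def_i -addrA -subr_eq0 opprD addrA subrr sub0r.
  rewrite oppr_eq0 -natrD => /eqP/(congr1 val); rewrite /= val_Zp_nat //.
  by rewrite modn_small; lia.
split=> [|t lt_ts]; first by rewrite def_i b0 addr0.
by rewrite eq_xy // b0 addn0.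
Qed.

Lemma seg_union i x s : (0 < s)%N ->
  seg i x s :|: seg (i + 1) (fun t => x t.+1) s = seg i x s.+1.
Proof.
move=> s_gt0; apply/setP=> a; rewrite inE; apply/orP/segP.
  case=> /segP[t lt_t ->]; first by exists t; rewrite // ltnW.
  by exists t.+1; rewrite // -addrA -natr1 [1 + _]addrC.
case=> [[|t] lt_t ->]; first by left; apply: mem_seg.
by right; rewrite -natr1 [_ + 1]addrC addrA; apply: (@mem_seg _ (fun t =>
  x t.+1)).
Qed.

Lemma card_seg i x s : (s <= r)%N -> #|seg i x s| = s.
Proof.
move=> le_sr; rewrite card_imset ?card_ord // => t u /pair_equal_spec[_ /addrI
  eq_tu].
by apply: val_inj; apply: natr_Zp_inj eq_tu; apply: leq_trans (ltn_ord _) _.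
Qed.

(** Both segments start at offset 0 or 1 in their union, and at different offsets because the union
    has [s + 1] points. The boolean [e] tells which of the two comes first. *)
Lemma seg_adjP U V s : (0 < s)%N -> (s.*2 <= r)%N ->
  isseg s U -> isseg s V ->
  isseg s.+1 (U :|: V) <->
  exists (e : bool) i x,
    (if e then V else U) = seg i x s /\
    (if e then U else V) = seg (i + 1) (fun t => x t.+1) s.
Proof.
move=> s_gt0 le_sr [i1 [x1 defU]] [i2 [x2 defV]]; split; last first.
  case=> [[] [i [x [def1 def2]]]]; exists i, x; rewrite -seg_union //.
    by rewrite -def1 -def2 setUC.
  by rewrite -def1 -def2.
case=> i [x defUV].
have [|b1 def_i1 eq_x1] := @seg_sub i x i1 x1 s s_gt0 le_sr.
  by rewrite -defUV -defU subsetUl.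
have [|b2 def_i2 eq_x2] := @seg_sub i x i2 x2 s s_gt0 le_sr.
  by rewrite -defUV -defV subsetUr.
have neq_b : b1 != b2.
  apply/eqP=> eq_b; have := card_seg i x (_ : s < r)%N.
  rewrite -defUV (_ : V = U) ?setUid ?defU ?card_seg; try lia.
  rewrite defV def_i2 def_i1 eq_b; apply: eq_seg => t lt_t.
  by rewrite eq_x1 // eq_x2 // eq_b.
exists b1, i, x; rewrite defU defV def_i1 def_i2.
case: b1 b2 neq_b eq_x1 eq_x2 {def_i1 def_i2} => [] [] // _ eq1 eq2.
  rewrite addr0; split; apply: eq_seg => t lt_t; first by rewrite eq2 // addn0.
  by rewrite eq1 // addn1.
rewrite addr0; split; apply: eq_seg => t lt_t; first by rewrite eq1 // addn0.
by rewrite eq2 // addn1.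
Qed.

End Segments.

(** * Traversing paths as segments *)

Lemma walk_subgraph_mkseq (T : finType) (p : nat -> T) n :
  walk_subgraph (mkseq p n.+1) =
  ([set p (val t) | t : 'I_n.+1], [set [set p (val t);
    p (val t).+1] | t : 'I_n]).
Proof.
rewrite /walk_subgraph; congr (_, _).
  apply/setP=> a; rewrite inE; apply/mapP/imsetP => [[t]|[t _ ->]].
    by rewrite mem_iota => lt_t ->; exists (Ordinal lt_t).
  by exists (val t); rewrite // mem_iota /= ltn_ord.
have -> : zip (mkseq p n.+1) (behead (mkseq p n.+1)) =
          mkseq (fun t => (p t, p t.+1)) n.
  have sz : size (zip (mkseq p n.+1) (behead (mkseq p n.+1))) = n.
    by rewrite size_zip size_behead !size_mkseq; lia.
  apply: (@eq_from_nth _ (p 0, p 0)) => [|t]; first by rewrite size_mkseq.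
  rewrite sz => lt_t; rewrite nth_zip_cond sz lt_t nth_behead !nth_mkseq //.
  exact: ltnW.
apply/setP=> e; rewrite inE -map_comp; apply/mapP/imsetP => [[t]|[t _ ->]].
  by rewrite mem_iota => lt_t ->; exists (Ordinal lt_t).
by exists (val t); rewrite // mem_iota /= ltn_ord.
Qed.

Section TraversingPathsAreSegments.

Variables (k r : nat).
Hypothesis r_gt2 : (2 < r)%N.

Local Notation point := ('I_k * 'Z_r)%type.

Definition seg_edges (i : 'Z_r) (x : nat -> 'I_k) (n : nat) :
    {set {set point}} :=
  [set [set (x (val t), i + (val t)%:R); (x (val t).+1, i + (val t).+1%:R)]
     | t : 'I_n].

(** A change of direction would return to the column visited two steps earlier, so the first step
    decides the direction of all others. *)
Lemma monotone_columns n (c : nat -> 'Z_r) :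
  (forall t, (t < n)%N -> c t - c t.+1 \in [:: -1; 1]) ->
  (forall t, (t.+1 < n)%N -> c t != c t.+2) ->
  (forall t, (t <= n)%N -> c t = c 0 + t%:R) \/
  (forall t, (t <= n)%N -> c t = c 0 - t%:R).
Proof.
move=> step no_turn.
have next t : (t < n)%N -> c t.+1 = c t + 1 \/ c t.+1 = c t - 1.
  move=> /step; rewrite !inE => /orP[]/eqP eq_c; [left|right].
    by rewrite -[1]opprK -eq_c opprB addrC subrK.
  by rewrite -eq_c opprB addrC subrK.
have cont d t : c 1 = c 0 + d -> d = 1 \/ d = -1 -> (t < n)%N ->
    c t.+1 = c t + d.
  move=> c1 d1; elim: t => [//|t IHt] lt_t.
  have := no_turn t lt_t; rewrite (IHt (ltnW lt_t)).
  have [] := next _ lt_t; rewrite (IHt (ltnW lt_t)) => ->; case: d1 => -> //.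
    by rewrite subrK eqxx.
  by rewrite addrK eqxx.
case: n => [|n] in step no_turn next cont *.
  by left=> t; rewrite leqn0 => /eqP->; rewrite addr0.
have [c1|c1] := next 0 isT; [left | right] => t.
  elim: t => [|t IHt] le_t; first by rewrite addr0.
  by rewrite (cont 1 t c1 (or_introl erefl) le_t) (IHt (ltnW le_t)) -addrA
    natr1.
elim: t => [|t IHt] le_t; first by rewrite subr0.
by rewrite (cont _ t c1 (or_intror erefl) le_t) (IHt (ltnW le_t)) -addrA -opprD
  natr1.
Qed.

(** A traversing path repeats no column, so its columns are monotone. A decreasing path is read from
    its other end, which gives the same subgraph. *)
Lemma traversing_pathP n (H : subgraph (C1 k r)) : (n < r)%N ->
  traversing_path n H <->
  exists i x, H = (seg i x n.+1, seg_edges i x n).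
Proof.
move=> lt_nr; split; last first.
  case=> i [x defH].
  pose p t : C1 k r := (x t, i + t%:R).
  have p_inj t u : (t < n.+1)%N -> (u < n.+1)%N -> (p t).2 = (p u).2 -> t = u.
    by move=> lt_t lt_u /addrI /(natr_Zp_inj r_gt2); apply; lia.
  have defH' : H = walk_subgraph (mkseq p n.+1).
    by rewrite walk_subgraph_mkseq.
  apply/andP; split.
    apply/existsP; exists (@Tuple _ _ (mkseq p n.+1) (introT eqP (size_mkseq _
      _))).
    rewrite -defH' eqxx andbT; apply/andP; split.
      change (uniq (mkseq p n.+1)).
      apply/mkseq_uniqP=> t u lt_t lt_u eq_p.
      by apply: p_inj => //; rewrite eq_p.
    change (sorted (@adj (C1 k r)) (mkseq p n.+1)).
    apply/(sortedP (p 0)) => t; rewrite size_mkseq => lt_t.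
    rewrite nth_mkseq ?(ltnW lt_t) // nth_mkseq //.
    change ((i + t%:R) - (i + t.+1%:R) \in [:: -1; 1 : 'Z_r]).
    rewrite opprD addrACA subrr add0r.
    by rewrite -natr1 opprD addrA subrr add0r !inE eqxx.
  rewrite /traversing; apply/forallP=> y; apply/card_le1_eqP=> a b.
  rewrite defH !inE => /andP[sa /eqP a2] /andP[sb /eqP b2].
  by apply/esym/(seg_column_inj r_gt2 lt_nr sa sb); rewrite a2 b2.
case/andP=> /existsP[p /and3P[Up adj_p /eqP defH]] /forallP trav.
move: (tval p) (size_tuple p) (thead p) Up adj_p defH.
move=> {}p sz_p p0 Up adj_p defH; pose q := nth p0 p.
have def_p : p = mkseq q n.+1 by rewrite -sz_p mkseq_nth.
have q_inj t u : (t < n.+1)%N -> (u < n.+1)%N -> (q t).2 = (q u).2 -> t = u.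
  move=> lt_t lt_u eq_q.
  have /card_le1_eqP/(_ (q t) (q u)) := trav (q u).2.
  rewrite !inE defH /= !inE !mem_nth ?sz_p // eq_q eqxx => /(_ isT isT) /eqP.
  by rewrite nth_uniq ?sz_p // => /eqP.
have step t : (t < n)%N -> (q t).2 - (q t.+1).2 \in [:: -1; 1].
  by move=> lt_t; move/(sortedP p0): adj_p; apply; rewrite sz_p.
have no_turn t : (t.+1 < n)%N -> (q t).2 != (q t.+2).2.
  by move=> lt_t; apply/eqP=> /q_inj; lia.
move: defH; rewrite def_p walk_subgraph_mkseq => ->.
have [up|down] := @monotone_columns n (fun t => (q t).2) step no_turn.
  have def_q t : (t < n.+1)%N -> q t = ((q t).1, (q 0).2 + t%:R).
    by move=> le_t; rewrite -up //; case: (q t).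
  exists (q 0).2, (fun t => (q t).1); congr (_, _); apply: eq_imset => t.
    by apply: def_q; apply: ltn_ord.
  congr [set _; _]; apply: def_q; last exact: ltn_ord.
  exact: leq_trans (ltn_ord t) _.
have def_q t : (t < n.+1)%N -> q (n - t)%N = ((q (n - t)%N).1, (q n).2 + t%:R).
  move=> le_t; case defq: (q (n - t)%N) => [y c] /=; congr (_, _).
  have := down _ (leq_subr t n); rewrite defq /= => ->.
  by rewrite natrB // opprB (down n (leqnn n)) addrCA addrC.
exists (q n).2, (fun t => (q (n - t)%N).1); congr (_, _); apply/setP=> a.
  apply/imsetP/segP => [[t _ ->]|[t lt_t ->]].
    exists (n - t)%N; first by rewrite ltnS leq_subr.
    by rewrite -def_q ?ltnS ?leq_subr // subKn // -ltnS.
  exists (rev_ord (Ordinal lt_t)); rewrite //= subSS -def_q //.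
apply/imsetP/imsetP => -[[t lt_t] _ ->]; exists (rev_ord (Ordinal lt_t)) => //.
  by rewrite /= -!def_q; try lia; rewrite setUC; congr [set q _; q _]; lia.
by rewrite /= -!def_q; try lia; rewrite setUC; congr [set q _; q _]; lia.
Qed.

Lemma seg_edges_union i x n : (0 < n)%N ->
  seg_edges i x n :|: seg_edges (i + 1) (fun t => x t.+1) n = seg_edges i x
    n.+1.
Proof.
have shift (t : nat) : i + 1 + t%:R = i + t.+1%:R :> 'Z_r.
  by rewrite -addrA nat1r.
move=> n_gt0; apply/setP=> e; rewrite inE; apply/orP/imsetP.
  case=> /imsetP[t _ ->]; first by exists (widen_ord (leqnSn n) t).
  by exists (lift ord0 t); rewrite //= !shift.
case=> -[[|t] lt_t] _ /= ->; first by left; apply/imsetP;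
  exists (Ordinal n_gt0).
by right; apply/imsetP; exists (Ordinal (lt_t : (t < n)%N)); rewrite //= !shift.
Qed.

Lemma eq_seg_edges i x y n : (forall t, (t <= n)%N -> x t = y t) ->
  seg_edges i x n = seg_edges i y n.
Proof.
by move=> eq_xy; apply: eq_imset => t /=; rewrite !eq_xy // ltnW.
Qed.

End TraversingPathsAreSegments.

(** A common interface for [s = 1] and [s >= 2]: the construction of the group uses only that
    vertices correspond to segments and that adjacency means having a segment as union. *)
Definition segment_coding (k r s : nat) (Gam : sgraph)
    (code : Gam -> {set 'I_k * 'Z_r}) : Prop :=
  [/\ injective code, forall v, isseg s (code v),
      forall S, isseg s S -> exists v, code v = S &
      forall u v, adj u v <-> isseg s.+1 (code u :|: code v)].

Lemma trav_graph_coding k r n : (0 < n)%N -> (n.+1.*2 <= r)%N ->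
  @segment_coding k r n.+1 (trav_graph k r n) (fun H => (val H).1).
Proof.
move=> n_gt0 le_nr; have r_gt2 : (2 < r)%N by lia.
have lt_nr : (n < r)%N by lia.
have lt_Snr : (n.+1 < r)%N by lia.
have pathV (H : trav_graph k r n) :
    exists i x, val H = (seg i x n.+1, seg_edges i x n).
  by apply/traversing_pathP => //; apply: valP.
split=> [H K|H|S [i [x defS]]|H K].
- have [i [x defH]] := pathV H; have [j [y defK]] := pathV K.
  rewrite defH defK /= => /(seg_inj r_gt2)[] // eq_ij eq_xy; apply: val_inj.
  by rewrite defH defK eq_ij (eq_seg _ eq_xy) (eq_seg_edges _ eq_xy).
- by have [i [x ->]] := pathV H; exists i, x.
- have pathS : traversing_path n (seg i x n.+1, seg_edges i x n).
    by apply/traversing_pathP => //; exists i, x.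
  by exists (Sub _ pathS : trav_graph k r n); rewrite defS.
have [i1 [x1 defH]] := pathV H; have [i2 [x2 defK]] := pathV K.
rewrite /= /trav_adj; split.
  by case/traversing_pathP=> // i [x] [defHK _]; exists i, x.
case/(seg_adjP r_gt2) => //; first by rewrite defH; exists i1, x1.
  by rewrite defK; exists i2, x2.
move=> e [i [x [def1 def2]]]; apply/traversing_pathP => //; exists i, x.
rewrite -seg_union // -seg_edges_union // /subgraphU.
(* The points of a segment determine its starting column and coordinates, hence its edges; this is
   why the code may forget the edges. *)
have edgesE (H' : trav_graph k r n) j y : (val H').1 = seg j y n.+1 ->
    (val H').2 = seg_edges j y n.
  have [j' [y' ->]] := pathV H' => /= /(seg_inj r_gt2)[] // -> eq_y.
  exact: eq_seg_edges.
by case: e def1 def2 => def1 def2;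
  rewrite -def1 -def2 -(edgesE _ _ _ def1) -(edgesE _ _ _ def2) // setUC [_.2
    :|: _]setUC.
Qed.

Lemma seg1 k r (i : 'Z_r) (x : nat -> 'I_k) : seg i x 1 = [set (x 0, i)].
Proof.
apply/setP=> a; rewrite inE; apply/segP/eqP=> [[[|//] _ ->]|->].
  by rewrite addr0.
by exists 0; rewrite ?addr0.
Qed.

Lemma C1_coding k r : (2 < r)%N ->
  @segment_coding k r 1 (C1 k r) (fun a => [set a]).
Proof.
move=> r_gt2.
have set1_seg (a : C1 k r) : isseg 1 [set a].
  by exists a.2, (fun=> a.1); rewrite seg1; case: a.
split=> // [|S [i [x ->]]|a b]; first exact: set1_inj.
  by exists (x 0, i); rewrite seg1.
rewrite (seg_adjP r_gt2) //; last by rewrite ltnW.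
rewrite /= /C1_adj !inE; split.
  case/orP=> /eqP eq_ab.
    exists false, a.2, (fun t => if t is 0 then a.1 else b.1); rewrite !seg1.
    by rewrite -[1]opprK -eq_ab opprB addrC subrK; case: (a) (b) => ? ? [].
  exists true, b.2, (fun t => if t is 0 then b.1 else a.1); rewrite !seg1.
  by rewrite -eq_ab addrC subrK; case: (a) (b) => ? ? [].
case=> -[] [i [x []]]; rewrite !seg1 => /set1_inj-> /set1_inj-> /=.
  by rewrite addrC addKr eqxx orbT.
by rewrite opprD addrA subrr add0r eqxx.
Qed.

(** * Dihedral column maps *)

(** Both sides have [s] points, so an inclusion suffices and [tau] need not be shown bijective. *)
Lemma imset_seg k r (g : {perm 'I_k * 'Z_r}) i x j y s (tau : nat -> nat) :
  (2 < r)%N -> (s <= r)%N ->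
  (forall u, (u < s)%N ->
     (tau u < s)%N /\ g (x u, i + u%:R) = (y (tau u), j + (tau u)%:R)) ->
  g @: seg i x s = seg j y s.
Proof.
move=> r_gt2 le_sr tauP; apply/eqP; rewrite eqEcard.
rewrite card_imset ?card_seg // ?leqnn ?andbT; last exact: perm_inj.
apply/subsetP=> _ /imsetP[_ /segP[u lt_u ->] ->].
by have [lt_tau ->] := tauP u lt_u; apply: mem_seg.
Qed.

Section Dihedral.

Variable r : nat.
Hypothesis r_gt2 : (2 < r)%N.

Definition dih (e : bool) (t c : 'Z_r) : 'Z_r := if e then t - c else t + c.

Lemma dihD e t c d : dih e t (c + d) = dih e t c + (if e then - d else d).
Proof. by case: e; rewrite /dih ?opprD addrA. Qed.

Lemma dih_comp e1 t1 e2 t2 c :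
  dih e2 t2 (dih e1 t1 c) = dih (e1 (+) e2) (dih e2 t2 t1) c.
Proof. by case: e1 e2 => [] [] //=; rewrite ?opprB ?opprD addrA // addrAC. Qed.

Lemma dih_inj e t : injective (dih e t).
Proof. by case: e => c d /addrI // /oppr_inj. Qed.

(** The images of the first and last columns lie at offsets in [[0, s)] that differ by [s - 1], with
    a sign given by [e]. So the first column goes to the first one under a translation and to the
    last one under a reflection. *)
Lemma dih_seg k (g : {perm 'I_k * 'Z_r}) e t i x j y s :
  (0 < s)%N -> (s.*2 <= r)%N ->
  (forall a, (g a).2 = dih e t a.2) -> g @: seg i x s = seg j y s ->
  dih e t i = j + (if e then s.-1 else 0)%:R.
Proof.
move=> s_gt0 le_sr colg im_g; have r_gt1 := ltnW r_gt2.
have get u : (u < s)%N ->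
    exists2 u', (u' < s)%N & dih e t (i + u%:R) = j + u'%:R.
  move=> lt_u; have /segP[u' lt_u' def_g] : g (x u, i + u%:R) \in seg j y s.
    by rewrite -im_g imset_f ?mem_seg.
  by exists u'; rewrite // -[i + _]/((x u, i + u%:R).2) -colg def_g.
have /get[u' lt_u'] : (s.-1 < s)%N by lia.
have [u lt_u] := get _ s_gt0.
rewrite addr0 dihD => ->; rewrite -!addrA.
case: e {colg get} => /= /addrI eq_u; congr (j + _%:R); apply/eqP.
  move/eqP: eq_u; rewrite subr_eq -natrD => /eqP /(natr_Zp_inj r_gt2); lia.
by move: eq_u; rewrite -natrD => /(natr_Zp_inj r_gt2); lia.
Qed.

End Dihedral.

(** * Recognising the permutation group induced on a set *)

Lemma perm_isomorphic_induced (Omega T : finType) (L : {group {perm Omega}})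
    (H : {group {perm T}}) (S : {set T}) (f : Omega -> T) :
  injective f -> (forall w, f w \in S) ->
  (forall y, y \in S -> exists w, f w == y) ->
  (forall g, g \in H -> exists2 h, h \in L & forall w, g (f w) = f (h w)) ->
  (forall h, h \in L -> exists2 g, g \in H & forall w, g (f w) = f (h w)) ->
  perm_isomorphic L (induced_perm_group H S).
Proof.
move=> f_inj fS f_onto H_to_L L_to_H.
pose F w : {x : T | x \in S} := Sub (f w) (fS w).
pose F' (y : {x : T | x \in S}) := xchoose (f_onto _ (valP y)).
have F'K : cancel F' F.
  by move=> y; apply: val_inj; apply/eqP/(xchooseP (f_onto _ (valP y))).
have F_inj : injective F by move=> w w' /(congr1 val)/f_inj.
have FK : cancel F F' by move=> w; apply: F_inj; rewrite F'K.
have act_inj (h : {perm Omega}) : injective (fun y => F (h (F' y))).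
  by move=> y y' /F_inj/perm_inj/(can_inj F'K).
pose psi h := perm (@act_inj h).
have psiE h w : psi h (F w) = F (h w) by rewrite permE FK.
have psiM : {in L &, {morph psi : h h' / (h * h')%g}}.
  by move=> h h' _ _; apply/permP=> y; rewrite -[y]F'K permM !psiE permM.
(* The restricted action is meaningful only for elements stabilising [S]; this follows from their
   agreement with elements of [L] along [f]. *)
have stabS g : g \in H -> g \in subact_dom (fun x => x \in S) 'P.
  move=> Hg; rewrite !inE /=; apply/subsetP=> y; rewrite !inE => Sy.
  have [w /eqP<-] := f_onto y Sy; have [h _] := H_to_L g Hg.
  by rewrite apermE => ->.
have actE g (h : {perm Omega}) : g \in H -> (forall w, g (f w) = f (h w)) ->
    actperm ('P^?)%act g = psi h.
  move=> Hg gh; apply/permP=> y; rewrite -[y]F'K psiE actpermE.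
  by apply: val_inj; rewrite val_subact stabS //= apermE gh.
exists F, (Morphism psiM); split; first by exists F'.
  apply/isomP; split.
    apply/injmP=> h h' _ _ /= eq_psi; apply/permP=> w; apply: F_inj.
    by rewrite -!psiE eq_psi.
  apply/setP=> q; apply/morphimP/morphimP => [[h Lh _ ->]|[g _ Hg ->]] /=.
    by have [g Hg gh] := L_to_H h Lh; exists g; rewrite ?stabS ?(actE g h).
  by have [h Lh gh] := H_to_L g Hg; exists h; rewrite ?(actE g h).
by move=> h w _ /=; rewrite psiE.
Qed.

(** * The group on the points of C(k,r,1) *)

Section TwistedGroup.

Variables (k l s : nat) (Omega : finType) (L : {group {perm Omega}}).
Hypotheses (l_gt0 : (0 < l)%N) (s_gt0 : (0 < s)%N).

Local Notation m := s.+1.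
Local Notation r := (2 * l * s.+1)%N.
Local Notation point := ('I_k * 'Z_r)%type.

(* [chi w] is the block of [w] and [kap w] its rank in that block. *)
Variables (chi : Omega -> bool) (kap : Omega -> 'I_k).
Variable iot : 'I_k -> bool -> Omega.
Hypothesis iot_kap : forall w, iot (kap w) (chi w) = w.
Hypothesis kap_iot : forall x b, kap (iot x b) = x.
Hypothesis chi_iot : forall x b, chi (iot x b) = b.
Hypothesis chiL : forall h w w', h \in L ->
  (chi (h w) == chi (h w')) = (chi w == chi w').
Hypothesis transL : forall w w', exists2 h, h \in L & h w = w'.

Let r_gt2 : (2 < r)%N. Proof. nia. Qed.
Let r_gt1 : (1 < r)%N. Proof. exact: ltnW. Qed.
Let le_mr : (m.*2 <= r)%N. Proof. nia. Qed.
Let le_sr : (s.*2 <= r)%N. Proof. nia. Qed.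

Lemma val_Zp_addn (c : 'Z_r) n : val (c + n%:R) = ((c + n) %% r)%N :> nat.
Proof. by rewrite /= val_Zp_nat // [X in (_ %% X)%N]Zp_cast // modnDmr. Qed.

Definition colour (c : 'Z_r) : bool := odd (c %/ m)%N.

Lemma colourDm c : colour (c + m%:R) = ~~ colour c.
Proof.
rewrite /colour -[nat_of_ord _]/(val (c + m%:R)) val_Zp_addn.
by rewrite -modn_divl odd_mod ?oddM // divnDr // divnn addn1.
Qed.

Lemma colourBm c : colour (c - m%:R) = ~~ colour c.
Proof. by rewrite -[in RHS](subrK m%:R c) colourDm negbK. Qed.

Lemma colour_dihDm e t c : colour (dih e t (c + m%:R)) = ~~ colour (dih e t c).
Proof. by rewrite dihD; case: e; rewrite ?colourDm ?colourBm. Qed.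

(* The columns [c] and [c + m] together carry a copy of [Omega]. *)
Definition label (a : point) : Omega := iot a.1 (colour a.2).

Lemma chi_label a : chi (label a) = colour a.2.
Proof. exact: chi_iot. Qed.

Lemma label_kap w c : chi w = colour c -> label (kap w, c) = w.
Proof. by rewrite /label /= => <-. Qed.

Lemma label_inj a b : a.2 = b.2 -> label a = label b -> a = b.
Proof.
case: a b => [x c] [y d] /= <- /(congr1 kap).
by rewrite /label !kap_iot /= => ->.
Qed.

(** The columns [c] and [c + m] have different colours, so the block of the label tells them
    apart. *)
Lemma label_inj2 c a b : a.2 = c \/ a.2 = c + m%:R ->
  b.2 = c \/ b.2 = c + m%:R -> label a = label b -> a = b.
Proof.
move=> ca cb eq_ab; apply: label_inj => //.
have := chi_label a; rewrite eq_ab chi_label.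
by case: ca cb => -> [] -> //; rewrite colourDm; case: colour.
Qed.

(** One [h] must serve both columns of a pair, but distinct pairs may use distinct elements, even
    the overlapping pairs [c, c + m] and [c + m, c + 2 m]. *)
Definition twisted : {set {perm point}} :=
  [set g : {perm point} |
    [exists e : bool, exists t : 'Z_r, forall a : point,
      (g a).2 == dih e t a.2] &&
    [forall c : 'Z_r, exists h in L, forall a : point,
      ((a.2 == c) || (a.2 == c + m%:R)) ==> (label (g a) == h (label a))]].

Lemma twistedP (g : {perm point}) :
  reflect ((exists e t, forall a, (g a).2 = dih e t a.2) /\
           (forall c, exists2 h, h \in L &
              forall a, a.2 = c \/ a.2 = c + m%:R -> label (g a) = h (label a)))
          (g \in twisted).
Proof.
rewrite inE; apply: (iffP andP) => -[].
  case/existsP=> e /existsP[t /forallP colg] /forallP actg; split.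
    by exists e, t => a; apply/eqP.
  move=> c; have /existsP[h /andP[Lh /forallP h_ok]] := actg c.
  exists h => // a ca; apply/eqP; apply: (implyP (h_ok a)); apply/orP.
  by case: ca => ->; [left | right].
case=> e [t colg] actg; split.
  by apply/existsP; exists e; apply/existsP; exists t; apply/forallP=> a;
    apply/eqP.
apply/forallP=> c; have [h Lh h_ok] := actg c.
apply/existsP; exists h; rewrite Lh /=; apply/forallP=> a; apply/implyP=> ca.
by apply/eqP/h_ok; case/orP: ca => /eqP; [left | right].
Qed.

Lemma twisted_group_set : group_set twisted.
Proof.
apply/group_setP; split.
  apply/twistedP; split=> [|c].
    by exists false, 0 => a; rewrite perm1 /dih add0r.
  by exists 1%g; rewrite ?group1 // => a _; rewrite !perm1.
move=> g1 g2 /twistedP[[e1 [t1 col1]] act1] /twistedP[[e2 [t2 col2]] act2].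
apply/twistedP; split=> [|c].
  exists (e1 (+) e2), (dih e2 t2 t1) => a.
  by rewrite permM col2 col1 dih_comp.
have [h1 Lh1 h1P] := act1 c.
(* A reflection reverses the pair: its image starts at the image of [c + m]. *)
have [h2 Lh2 h2P] := act2 (if e1 then dih e1 t1 (c + m%:R) else dih e1 t1 c).
exists (h1 * h2)%g; first exact: groupM.
move=> a ca; rewrite !permM -h1P // h2P // col1.
case: ca => ->; rewrite dihD; case: (e1) => /=; rewrite ?subrK; tauto.
Qed.

Canonical twisted_group := Group twisted_group_set.

(** A label determines the point within a given column, so a permutation may be prescribed by a
    column map and one permutation [ell c] of labels per column. Only the action of [ell c] on the
    block carried by [c] matters, and the first hypothesis sends this block to that of the image
    column. *)
Lemma twisted_build e t (ell : 'Z_r -> {perm Omega}) :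
  (forall c w, chi w = colour c -> chi (ell c w) = colour (dih e t c)) ->
  (forall c, exists2 h, h \in L &
     (forall w, chi w = colour c -> ell c w = h w) /\
     (forall w, chi w = ~~ colour c -> ell (c + m%:R) w = h w)) ->
  exists2 g, g \in twisted &
    forall a, (g a).2 = dih e t a.2 /\ label (g a) = ell a.2 (label a).
Proof.
move=> col_ell act_ell.
pose f (a : point) : point := (kap (ell a.2 (label a)), dih e t a.2).
have label_f a : label (f a) = ell a.2 (label a).
  by rewrite /f label_kap // col_ell // chi_label.
have f_inj : injective f.
  move=> a b eq_f; have eq2 : a.2 = b.2.
    by apply: (@dih_inj r e t); rewrite -![dih e t _]/((f _).2) eq_f.
  apply: label_inj => //; apply: (@perm_inj _ (ell a.2)).
  by rewrite -label_f eq_f label_f eq2.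
exists (perm f_inj) => [|a]; last by rewrite permE label_f.
apply/twistedP; split=> [|c]; first by exists e, t => a; rewrite permE.
have [h Lh [h1 h2]] := act_ell c; exists h => // a ca.
rewrite permE label_f; case: ca => ca; rewrite ca.
  by apply: h1; rewrite chi_label ca.
by apply: h2; rewrite chi_label ca colourDm.
Qed.

Lemma chiL_compat h w0 b : h \in L -> chi (h w0) = b ->
  forall w, chi w = chi w0 -> chi (h w) = b.
Proof. by move=> Lh <- w /eqP; rewrite -(chiL _ _ Lh) => /eqP. Qed.

Lemma chiL_negb h w w' : h \in L -> chi w' = ~~ chi w ->
  chi (h w') = ~~ chi (h w).
Proof.
by move=> Lh; have := chiL w w' Lh; do 4!case: (chi _).
Qed.

(** * Elements prescribed on residue classes of columns modulo [m] *)

Definition residue (i c : 'Z_r) : nat := (val (c - i)%R %% m)%N.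

Lemma residueDm i c : residue i (c + m%:R) = residue i c.
Proof.
rewrite /residue addrAC val_Zp_addn modn_dvdm ?dvdn_mull //.
by rewrite modnDr.
Qed.

Lemma residue_lt i c : (residue i c < m)%N.
Proof. exact: ltn_pmod. Qed.

Lemma val_natr u : (u < r)%N -> val (u%:R : 'Z_r) = u.
Proof. by move=> lt_u; rewrite /= val_Zp_nat // modn_small. Qed.

Lemma residue_nat i u : (u < m)%N -> residue i (i + u%:R) = u.
Proof.
by move=> lt_u; rewrite /residue addrC addKr val_natr ?modn_small //; lia.
Qed.

Lemma column_eq (i c : 'Z_r) : c = i + (val (c - i))%:R.
Proof. by rewrite natr_Zp addrC subrK. Qed.

Lemma column_ind (P : 'Z_r -> Prop) i :
  (forall u, (u < m)%N -> P (i + u%:R)) -> (forall c, P c -> P (c + m%:R)) ->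
  forall c, P c.
Proof.
move=> Pbase Pstep c; rewrite (column_eq i c) (divn_eq (val (c - i)) m).
elim: (_ %/ m)%N => [|q IHq]; first by rewrite mul0n; apply: Pbase;
  rewrite ltn_pmod.
by rewrite (mulSn q m) -addnA natrD [m%:R + _]addrC addrA; apply: Pstep.
Qed.

(** One element of [L] is used on a whole residue class. The colour condition spreads from the [m]
    columns starting at [i], since a step of [m] flips the colours of both the column and its
    image. *)
Lemma twisted_periodic e t i (h : nat -> {perm Omega}) :
  (forall u, (u < m)%N -> h u \in L) ->
  (forall u, (u < m)%N -> forall w, chi w = colour (i + u%:R) ->
     chi (h u w) = colour (dih e t (i + u%:R))) ->
  exists2 g, g \in twisted &
    forall a, (g a).2 = dih e t a.2 /\
              label (g a) = h (residue i a.2) (label a).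
Proof.
move=> Lh col_h; apply: (@twisted_build e t (fun c => h (residue i c))).
  apply: (@column_ind _ i) => [u lt_u|c IHc] w chi_w.
    by rewrite residue_nat // col_h.
  rewrite residueDm colour_dihDm; rewrite colourDm in chi_w.
  (* The induction hypothesis is applied to a point of the block opposite to that of [w]; elements
     of [L] keep the two points in opposite blocks. *)
  rewrite -(IHc (iot (kap w) (colour c))) ?chi_iot //.
  by apply: chiL_negb; rewrite ?Lh ?residue_lt ?chi_iot.
move=> c; exists (h (residue i c)); first by rewrite Lh ?residue_lt.
by split=> w _; rewrite ?residueDm.
Qed.

(** By transitivity the default is never taken. *)
Definition mover (w w' : Omega) : {perm Omega} :=
  odflt 1%g [pick h in L | h w == w'].

Lemma moverP w w' : mover w w' \in L /\ mover w w' w = w'.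
Proof.
rewrite /mover; case: pickP => [h /andP[Lh /eqP]//|none].
by have [h Lh hw] := transL w w'; have := none h; rewrite Lh hw eqxx.
Qed.

Lemma mover_chi w w' v : chi v = chi w -> chi (mover w w' v) = chi w'.
Proof.
by have [Lh hw] := moverP w w'; apply: chiL_compat; rewrite ?hw.
Qed.

(** The [m] columns lie in distinct residue classes, so a mover can be chosen for each of them
    independently. The target coordinates [x'] are indexed by the position in the source. *)
Lemma twisted_move e t i (x x' : nat -> 'I_k) :
  exists2 g, g \in twisted &
    (forall a, (g a).2 = dih e t a.2) /\
    (forall u, (u < m)%N -> g (x u, i + u%:R) = (x' u, dih e t (i + u%:R))).
Proof.
pose h u := mover (label (x u, i + u%:R)) (label (x' u, dih e t (i + u%:R))).
have [u lt_u|u lt_u w chi_w|g Gg gP] := @twisted_periodic e t i h.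
- by case: (moverP (label (x u, i + u%:R)) (label (x' u, dih e t (i + u%:R)))).
- by rewrite mover_chi ?chi_label.
exists g => //; split=> [a|u lt_u]; first by case: (gP a).
have [col_g lab_g] := gP (x u, i + u%:R).
apply: label_inj => //; rewrite lab_g residue_nat //.
by case: (moverP (label (x u, i + u%:R)) (label (x' u, dih e t (i + u%:R)))).
Qed.

Lemma isseg_imset g n S : (0 < n)%N -> (n <= r)%N ->
  g \in twisted -> isseg n S -> isseg n (g @: S).
Proof.
move=> n_gt0 le_nr /twistedP[[e [t col_g]] _] [i [x ->]].
(* A reflection reverses the order of the columns of a segment. *)
pose tau u := if e then (n.-1 - u)%N else u.
have tau_lt u : (u < n)%N -> (tau u < n)%N by rewrite /tau;
  case: e {col_g tau}; lia.
have tauK u : (u < n)%N -> tau (tau u) = u.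
  by rewrite /tau; case: e {col_g tau tau_lt}; lia.
exists (dih e t i - (if e then n.-1 else 0)%:R).
exists (fun u => (g (x (tau u), i + (tau u)%:R)).1).
apply: (@imset_seg _ _ _ _ _ _ _ _ tau) => // u lt_u; split;
  first exact: tau_lt.
rewrite tauK // [LHS]surjective_pairing col_g dihD /tau; congr (_, _).
case: (e); last by rewrite subr0.
by rewrite natrB ?addrA ?subrK //; lia.
Qed.


(** The two columns flanking a segment of [s = m - 1] columns differ by [m], so together they carry
    one copy of [Omega]. This is where the length [m - 1] matters. *)
Lemma side_columns (i : 'Z_r) : i - 1 + m%:R = i + s%:R.
Proof. by rewrite -natr1 addrACA addNr addr0. Qed.

Lemma natr_pred_s : (s.-1)%:R = s%:R - 1 :> 'Z_r.
Proof. by rewrite -subn1 natrB. Qed.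

(** A column map preserving the segment fixes or exchanges the two flanking columns, so [g] acts on
    this pair as an element of [L]. *)
Lemma twisted_stab_local g i x : g \in twisted ->
  g @: seg i x s = seg i x s ->
  exists2 h, h \in L & forall a, a.2 = i - 1 \/ a.2 = i - 1 + m%:R ->
    ((g a).2 = i - 1 \/ (g a).2 = i - 1 + m%:R) /\ label (g a) = h (label a).
Proof.
move=> /twistedP[[e [t col_g]] act_g] stab_g.
have dih_i := dih_seg r_gt2 s_gt0 le_sr col_g stab_g.
have [h Lh hP] := act_g (i - 1); exists h => // a ca; split; last exact: hP.
rewrite col_g; move: ca; rewrite side_columns; case=> ->.
  rewrite dihD dih_i; case: (e); last by left; rewrite addr0.
  by right; rewrite natr_pred_s opprK addrA subrK.
rewrite dihD dih_i; case: (e); last by right; rewrite addr0.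
by left; rewrite natr_pred_s addrA addrAC addrK.
Qed.

(** If [h] exchanges the blocks, a reflection exchanging the flanking columns is taken, otherwise
    the identity on columns. The residue class of the flanking columns receives [h]; the other
    classes receive movers that preserve the segment. *)
Lemma twisted_realise h i x : h \in L ->
  exists2 g, g \in twisted &
    g @: seg i x s = seg i x s /\
    forall a, a.2 = i - 1 \/ a.2 = i - 1 + m%:R ->
    ((g a).2 = i - 1 \/ (g a).2 = i - 1 + m%:R) /\ label (g a) = h (label a).
Proof.
move=> Lh; pose w0 := iot (x 0) (colour (i - 1));
  pose e := chi (h w0) != chi w0.
pose t := if e then i - 1 + (i - 1 + m%:R) else 0.
pose tau u := if e then (m - u)%N else u.
(* For [u > 0] this is the point of the segment at position [u - 1]; the value at 0 is a dummy. *)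
pose p u : point := (x u.-1, i - 1 + u%:R).
have dih_tau u : (u <= m)%N -> dih e t (i - 1 + u%:R) = i - 1 + (tau u)%:R.
  move=> le_u; rewrite /dih /t /tau; case: e {t tau}; last by rewrite add0r.
  by rewrite natrB // opprD addrACA subrr add0r addrA.
pose hh u := if u is 0 then h else mover (label (p u)) (label (p (tau u))).
have [u lt_u|u lt_u w chi_w|g Gg gP] := @twisted_periodic e t (i - 1) hh.
- case: u lt_u => [|u] // lt_u.
  by case: (moverP (label (p u.+1)) (label (p (tau u.+1)))).
- rewrite dih_tau 1?ltnW //; case: u lt_u chi_w => [|u] lt_u chi_w; last first.
    by rewrite mover_chi ?chi_label.
  rewrite addr0 in chi_w.
  apply: (chiL_compat (w0 := w0)); rewrite ?chi_iot //.
  have : chi (h w0) = e (+) chi w0 by rewrite /e; do 2!case: (chi _).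
  rewrite /tau => ->; rewrite chi_iot; case: (e); last by rewrite addr0.
  by rewrite subn0 colourDm.
exists g => //; split=> [|a ca]; last first.
  have [-> ->] := gP a; split.
    case: ca => ->.
      have := dih_tau 0 isT; rewrite addr0 => ->; rewrite /tau.
      by case: (e); [right; rewrite subn0 | left; rewrite addr0].
    by rewrite dih_tau // /tau; case: (e); [left; rewrite subnn addr0 | right].
  suff -> : residue (i - 1) a.2 = 0 by [].
  have := residue_nat (i - 1) (ltn0Sn s); rewrite addr0.
  by case: ca => ->; rewrite ?residueDm.
have shift u : i + u%:R = i - 1 + u.+1%:R :> 'Z_r.
  by rewrite -nat1r addrA subrK.
apply: (@imset_seg _ _ _ _ _ _ _ _ (fun u => (tau u.+1).-1)) => // [|u lt_u].
  by rewrite (leq_trans _ le_mr) //; lia.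
have tau_gt0 : (0 < tau u.+1 <= s)%N by rewrite /tau; case: (e); lia.
split; first by lia.
have [col_g lab_g] := gP (p u.+1).
rewrite !shift prednK; last by case/andP: tau_gt0.
apply: label_inj.
  by apply: (etrans col_g); apply: dih_tau; rewrite ltnS ltnW.
apply: (etrans lab_g); rewrite [residue _ _]residue_nat //.
by case: (moverP (label (p u.+1)) (label (p (tau u.+1)))).
Qed.

(** The two segments of constant coordinate that start and end at [a] have only [a] in common,
    because [2 s < r]. *)
Lemma twisted_faithful (g : {perm point}) :
  (forall S, isseg s S -> g @: S = S) -> g = 1%g.
Proof.
move=> fix_g; apply/permP=> a; rewrite perm1.
have lt_s : (s.*2 < r)%N by lia.
pose S1 := seg a.2 (fun=> a.1) s.
pose S2 := seg (a.2 - (s.-1)%:R) (fun=> a.1) s.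
have S1a : a \in S1 by apply/segP; exists 0; rewrite ?addr0 //; case: (a).
have S2a : a \in S2.
  by apply/segP; exists s.-1; [lia | rewrite subrK; case: (a)].
have S1g : g a \in S1.
  by rewrite -[S1]fix_g ?imset_f //; exists a.2, (fun=> a.1).
have : g a \in S2.
  by rewrite -[S2]fix_g ?imset_f //; exists (a.2 - (s.-1)%:R), (fun=> a.1).
case/segP=> u2 lt_u2 def_ga2; case/segP: (S1g) => u1 lt_u1 def_ga1.
apply: (seg_column_inj r_gt2 _ S1g S1a); first by lia.
have: (u1 + s.-1)%:R = u2%:R :> 'Z_r.
  move: def_ga2; rewrite def_ga1 => /pair_equal_spec[_].
  by rewrite -addrA => /addrI eq_u; rewrite natrD eq_u addrAC addNr add0r.
move/(natr_Zp_inj r_gt2) => eq_u.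
rewrite def_ga1; have -> : u1 = 0 by lia.
exact: addr0.
Qed.

(** * The order of an arc-stabiliser *)

Definition arc_stab i x : {set {perm point}} :=
  [set g in twisted | (g @: seg i x s == seg i x s) &&
    (g @: seg (i + 1) (fun u => x u.+1) s == seg (i + 1) (fun u => x u.+1) s)].

(** Stabilising both segments excludes reflections, which reverse the order of the columns, and
    nontrivial translations. The union of the segments is then preserved column by column, hence
    pointwise. *)
Lemma arc_stabP i x (g : {perm point}) :
  reflect [/\ g \in twisted, forall a, (g a).2 = a.2 &
             forall u, (u < m)%N -> g (x u, i + u%:R) = (x u, i + u%:R)]
          (g \in arc_stab i x).
Proof.
have shift u : i + 1 + u%:R = i + u.+1%:R :> 'Z_r by rewrite -addrA nat1r.
apply: (iffP setIdP) => [[Gg /andP[/eqP fix1 /eqP fix2]]|]; last first.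
  have le_s : (s <= r)%N by lia.
  case=> Gg col_g fix_g; split=> //.
  apply/andP; split; apply/eqP; apply: (imset_seg (tau := id)) => // u lt_u.
    by rewrite fix_g // ltnW.
  by rewrite shift fix_g.
have /twistedP[[e [t col_g]] _] := Gg.
have dih1 := dih_seg r_gt2 s_gt0 le_sr col_g fix1.
have dih2 := dih_seg r_gt2 s_gt0 le_sr col_g fix2.
have col1 a : (g a).2 = a.2.
  rewrite col_g; move: dih2; rewrite dihD dih1; case: (e) dih1 => dih1.
    rewrite [in LHS]addrAC => /addIr /addrI eqN1.
    (* For a reflection the two conditions give [-1 = 1], impossible for [r > 2]. *)
    have : 2%:R = 0%:R :> 'Z_r by rewrite mulr2n -{1}eqN1 addNr.
    by move/(natr_Zp_inj r_gt2); lia.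
  have -> : t = 0 by apply: (addIr i); rewrite add0r -[RHS]addr0; exact: dih1.
  by rewrite /dih add0r.
split=> // u lt_u.
have W_u : (x u, i + u%:R) \in seg i x m by apply: mem_seg.
apply: (seg_column_inj r_gt2 _ _ W_u) => //; first by lia.
rewrite -{1}(seg_union _ _ s_gt0) -fix1 -fix2 -imsetU seg_union //.
exact: imset_f.
Qed.

Section ArcStabiliser.

Variables (i : 'Z_r) (x : nat -> 'I_k).

Definition offset (c : 'Z_r) : nat := val (c - i).

(** The representative of the residue class of [c] among the columns [i, ..., i + m - 1]. *)
Definition base (c : 'Z_r) : 'Z_r := i + (residue i c)%:R.

(* The columns of offset [u] in [m <= u < 2 m] carry no parameter: the action
   there is that of the element of [L] attached to offset [u - m]. *)
Definition param_set (c : 'Z_r) : {set {perm Omega}} :=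
  if (offset c < m)%N then 'C_L[label (x (offset c), c) | 'P]%g
  else if (offset c < m.*2)%N then 1%g
  else 'C_L([set w | chi w != colour c] | 'P)%g.

Definition fibre_part (P : {ffun 'Z_r -> {perm Omega}}) (c : 'Z_r) :=
  if (offset c < m)%N then 1%g else P c.

(** Products act from left to right: labels in column [c] are first moved by an element trivial on
    the block opposite to that of [c], then by the element attached to the residue class. The first
    factor is 1 when [c] is itself a base column, whose parameter must not act twice. *)
Definition param_act (P : {ffun 'Z_r -> {perm Omega}}) (c : 'Z_r) :=
  (fibre_part P c * P (base c))%g.

Lemma offset_nat u : (u < r)%N -> offset (i + u%:R) = u.
Proof. by move=> lt_u; rewrite /offset addrC addKr val_natr. Qed.

Lemma baseDm c : base (c + m%:R) = base c.
Proof. by rewrite /base residueDm. Qed.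

Lemma offset_base c : offset (base c) = residue i c.
Proof. by rewrite offset_nat // (leq_trans (residue_lt i c)) //; lia. Qed.

Lemma offset_base_lt c : (offset (base c) < m)%N.
Proof. by rewrite offset_base residue_lt. Qed.

Lemma base_id c : (offset c < m)%N -> base c = c.
Proof.
by move=> lt_c; rewrite [RHS](column_eq i) /base /residue modn_small.
Qed.

Lemma offsetDm c : (offset c < m)%N -> offset (c + m%:R) = (offset c + m)%N.
Proof.
move=> lt_c; rewrite {1}(column_eq i c) -addrA -natrD offset_nat //.
by rewrite -[val _]/(offset c); lia.
Qed.

Lemma second_turn c : (m <= offset c < m.*2)%N -> c = base c + m%:R.
Proof.
move=> ltc; rewrite {1}(column_eq i c) /base /residue -addrA -natrD.
congr (_ + _%:R); rewrite -[val _]/(offset c) -{2}(subnK (_ : m <= offset c)%N)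
  ?modnDr ?modn_small; lia.
Qed.

Lemma fix_chi h w0 w : h \in L -> h w0 = w0 -> chi (h w) = chi w.
Proof.
by move=> Lh fix_w0; have := chiL w w0 Lh; rewrite fix_w0; do 3!case: (chi _).
Qed.

Section InFamily.

Variable P : {ffun 'Z_r -> {perm Omega}}.
Hypothesis famP : P \in family param_set.

Lemma param_in_L c : P c \in L.
Proof.
have /familyP/(_ c) := famP; rewrite /param_set.
by do 2?[case: ifP => _]; [case/setIP | move/set1P->;
  apply: group1 | case/setIP].
Qed.

Lemma param_fix c : (offset c < m)%N ->
  P c (label (x (offset c), c)) = label (x (offset c), c).
Proof.
have /familyP/(_ c) := famP; rewrite /param_set => Pc lt_c; move: Pc.
by rewrite lt_c => /setIP[_ /astab1P].
Qed.

Lemma param_one c : (m <= offset c < m.*2)%N -> P c = 1%g.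
Proof.
have /familyP/(_ c) := famP; rewrite /param_set => Pc /andP[le_c lt_c].
by move: Pc; rewrite ltnNge le_c lt_c => /set1P.
Qed.

Lemma fibre_part_in_L c : fibre_part P c \in L.
Proof. by rewrite /fibre_part; case: ifP => _; rewrite ?group1 ?param_in_L. Qed.

Lemma fibre_part_fix c w : chi w = ~~ colour c -> fibre_part P c w = w.
Proof.
move=> chi_w; rewrite /fibre_part; have /familyP/(_ c) := famP.
rewrite /param_set; case: ifP => _; first by rewrite perm1.
case: ifP => _; first by move/set1P->; rewrite perm1.
case/setIP=> _ /astabP/(_ w); apply.
by rewrite inE chi_w; case: colour.
Qed.

Lemma fibre_part_chi c w : chi (fibre_part P c w) = chi w.
Proof.
apply: (@fix_chi _ (iot (kap w) (~~ colour c))); first exact: fibre_part_in_L.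
by rewrite fibre_part_fix ?chi_iot.
Qed.

Lemma param_act_chi c w : chi (param_act P c w) = chi w.
Proof.
rewrite permM (fix_chi _ (param_in_L _) (param_fix (offset_base_lt c))).
exact: fibre_part_chi.
Qed.

Lemma param_perm : exists2 g, g \in arc_stab i x &
  forall a, (g a).2 = a.2 /\ label (g a) = param_act P a.2 (label a).
Proof.
have [c w chi_w|c|g Gg gP] := @twisted_build false 0 (param_act P).
- by rewrite param_act_chi chi_w /dih add0r.
(* Each fibre part is trivial on the block of the other column, so either column of the pair sees
   only its own factor. *)
- exists (fibre_part P c * fibre_part P (c + m%:R) * P (base c))%g.
    by rewrite !groupM ?fibre_part_in_L ?param_in_L.
  split=> w chi_w; rewrite /param_act ?baseDm !permM.
    by rewrite (@fibre_part_fix (c + _)) // fibre_part_chi colourDm negbK.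
  by rewrite (fibre_part_fix chi_w).
have col_g a : (g a).2 = a.2 by case: (gP a) => ->; rewrite /dih add0r.
exists g => [|a]; last by case: (gP a).
apply/arc_stabP; split=> // u lt_u; apply: label_inj => //.
have [_ ->] := gP (x u, i + u%:R).
have off_u : offset (i + u%:R) = u by apply: offset_nat; lia.
rewrite /param_act /fibre_part /= off_u lt_u mul1g base_id ?off_u //.
by have := @param_fix (i + u%:R); rewrite off_u; apply.
Qed.

End InFamily.

(** The choice makes the map total: outside the family the formula need not define a permutation. *)
Definition param_to_perm (P : {ffun 'Z_r -> {perm Omega}}) : {perm point} :=
  odflt 1%g [pick g : {perm point} |
    [forall a, g a == (kap (param_act P a.2 (label a)), a.2)]].

Lemma param_to_perm_eq P (g : {perm point}) :
  (forall a, (g a).2 = a.2 /\ label (g a) = param_act P a.2 (label a)) ->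
  param_to_perm P = g.
Proof.
move=> gP; have gE a : g a = (kap (param_act P a.2 (label a)), a.2).
  by have [<- <-] := gP a; rewrite kap_iot -surjective_pairing.
rewrite /param_to_perm; case: pickP => [g' /forallP g'P|/(_ g)/forallP[]a] /=.
  by apply/permP=> a; rewrite gE; apply/eqP.
by rewrite gE.
Qed.

(** The parameter of a base column [c] is read off on one block from column [c], and on the other
    from column [c + m], where the fibre part is trivial. The remaining parameters follow by
    cancelling the base element. *)
Lemma param_to_perm_inj : {in family param_set &, injective param_to_perm}.
Proof.
move=> P Q famP famQ eq_PQ.
have [g _ gP] := param_perm famP; have [g' _ g'P] := param_perm famQ.
have def_g : g = g'.
  by rewrite -(param_to_perm_eq gP) -(param_to_perm_eq g'P).
rewrite -{g'}def_g in g'P.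
have eq_act c w : chi w = colour c -> param_act P c w = param_act Q c w.
  move=> chi_w; rewrite -(label_kap chi_w).
  by have [_ <-] := gP (kap w, c); have [_ <-] := g'P (kap w, c).
have eq_base c : (offset c < m)%N -> P c = Q c.
  move=> lt_c; apply/permP=> w.
  have [chi_w|] := eqVneq (chi w) (colour c).
    have := eq_act c w chi_w.
    by rewrite /param_act /fibre_part lt_c !mul1g base_id.
  move=> chi_w; have := eq_act (c + m%:R) w.
  rewrite colourDm /param_act /fibre_part baseDm base_id // offsetDm //.
  have off_c : (m <= offset (c + m%:R)%R < m.*2)%N by rewrite offsetDm //; lia.
  rewrite ltnNge leq_addl /= (param_one famP off_c) (param_one famQ off_c)
    !mul1g.
  by apply; case: (chi w) (colour c) chi_w => [] [].
apply/ffunP=> c; have [/eq_base//|le_c] := ltnP (offset c) m.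
apply/permP=> w; have fibreE R : fibre_part R c = R c.
  by rewrite /fibre_part ltnNge le_c.
have [chi_w|chi_w] := eqVneq (chi w) (colour c).
  have := eq_act c w chi_w; rewrite /param_act !permM !fibreE.
  by rewrite (eq_base (base c)) ?offset_base_lt // => /perm_inj.
have {}chi_w : chi w = ~~ colour c by case: (chi w) (colour c) chi_w => [] [].
by rewrite -!fibreE (fibre_part_fix famP) ?(fibre_part_fix famQ).
Qed.

(* Going from column [c] to [c + m], both [hh c] and [n * hh (base c)] describe
   [g] on column [c], hence they differ by an element of [L] fixing the block of
   [c]. In particular, there is no condition for closing up the cycle of 2 l
   columns. *)
Lemma fibre_part_exists (g : {perm point}) (hh : 'Z_r -> {perm Omega}) :
  (forall a, (g a).2 = a.2) ->
  (forall c, hh c \in L /\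
     forall a, a.2 = c \/ a.2 = c + m%:R -> label (g a) = hh c (label a)) ->
  forall c, exists2 n, n \in L &
    (forall w, chi w = ~~ colour c -> n w = w) /\
    (forall w, chi w = colour c ->
       label (g (kap w, c)) = hh (base c) (n w)).
Proof.
move=> col_g hhP; apply: (@column_ind _ i) => [u lt_u|c [n Ln [n_fix n_act]]].
  exists 1%g; first exact: group1.
  split=> w chi_w; rewrite perm1 //.
  have [_ ->] := hhP (i + u%:R); last by left.
  by rewrite label_kap // base_id // offset_nat //; lia.
have [Lh h_act] := hhP c; have [Lb _] := hhP (base c).
(* On the block of [c], [q] agrees with [n]. *)
pose q := (hh c * (hh (base c))^-1)%g.
have Lq : q \in L by rewrite groupM ?groupV.
have q_n w : chi w = colour c -> q w = n w.
  move=> chi_w; rewrite permM -[in hh c w](label_kap chi_w) -h_act;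
    last by left.
  by rewrite n_act // permK.
(* Since [n] has fixed points in the other block, it preserves both blocks; [q] agrees with it on
   one block and so preserves them as well. *)
have q_chi w : chi (q w) = chi w.
  pose w1 := iot (kap w) (colour c); pose w2 := iot (kap w) (~~ colour c).
  have n2 : n w2 = w2 by rewrite n_fix ?chi_iot.
  have: chi (q w1) = chi w1 by rewrite q_n ?chi_iot // (fix_chi _ Ln n2)
    chi_iot.
  by have := chiL w w1 Lq; do 4!case: (chi _).
(* The product is trivial on the block of [c], which is opposite to that of [c + m]; on the other
   block [n^-1] is trivial and only [q] acts. *)
exists (q * n^-1)%g; first by rewrite groupM ?groupV.
rewrite colourDm baseDm; split=> w chi_w; rewrite permM.
  by rewrite q_n ?permK // -[colour c]negbK.
have -> : (n^-1)%g (q w) = q w.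
  by rewrite -{1}(n_fix (q w)) ?permK // q_chi.
rewrite permM permKV h_act; last by right.
by rewrite label_kap // colourDm.
Qed.

(** The element [hh (base c)] describes [g] on both the base column and the next one of its class,
    so the parameter at offsets in [[m, 2 m)] can be 1. The later columns take their fibre parts
    from [fibre_part_exists]. *)
Lemma param_to_perm_onto g : g \in arc_stab i x ->
  exists2 P, P \in family param_set & param_to_perm P = g.
Proof.
case/arc_stabP=> Gg col_g fix_g.
have /twistedP[_ act_g] := Gg.
pose hh c := odflt 1%g [pick h in L | [forall a : point,
  ((a.2 == c) || (a.2 == c + m%:R)) ==> (label (g a) == h (label a))]].
have hhP c : hh c \in L /\
    forall a, a.2 = c \/ a.2 = c + m%:R -> label (g a) = hh c (label a).
  rewrite /hh; case: pickP => [h /andP[Lh /forallP hP]|none] /=.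
    split=> // a ca; apply/eqP; apply: (implyP (hP a)).
    by case: ca => ->; rewrite eqxx ?orbT.
  have [h Lh hP] := act_g c; have := none h; rewrite Lh => /forallP[] a.
  by apply/implyP=> ca; apply/eqP/hP; case/orP: ca => /eqP; [left | right].
pose nn c := odflt 1%g [pick n in L |
  [forall w, (chi w == ~~ colour c) ==> (n w == w)] &&
  [forall w, (chi w == colour c) ==> (label (g (kap w, c)) == hh (base c) (n
    w))]].
have nnP c : nn c \in L /\
    (forall w, chi w = ~~ colour c -> nn c w = w) /\
    (forall w, chi w = colour c -> label (g (kap w, c)) = hh (base c) (nn c w)).
  rewrite /nn; case: pickP => [n /and3P[Ln /forallP n1 /forallP n2]|none] /=.
    split=> //; split=> w chi_w; apply/eqP.
      by apply: (implyP (n1 w)); apply/eqP.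
    by apply: (implyP (n2 w)); apply/eqP.
  have [n Ln [n1 n2]] := fibre_part_exists col_g hhP c.
  have /negP[] := negbT (none n); rewrite Ln andTb; apply/andP; split.
    by apply/forallP=> w; apply/implyP=> /eqP/n1->.
  by apply/forallP=> w; apply/implyP=> /eqP/n2->.
pose P := [ffun c => if (offset c < m)%N then hh c
                     else if (offset c < m.*2)%N then 1%g else nn c].
exists P.
  apply/familyP=> c; rewrite ffunE /param_set; case: ifP => [lt_c|_].
    have [Lh h_act] := hhP c; rewrite inE Lh; apply/astab1P; rewrite /= apermE.
    rewrite -h_act; last by left.
    by rewrite {1}[c in (_, c)](column_eq i) fix_g // -column_eq.
  case: ifP => _; first exact: group1.
  have [Ln [n1 _]] := nnP c; rewrite inE Ln; apply/astabP=> w.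
  by rewrite inE /= apermE => chi_w; apply: n1;
    case: (chi w) (colour c) chi_w => [] [].
apply: param_to_perm_eq => a; split=> //.
have Pb : P (base a.2) = hh (base a.2) by rewrite ffunE offset_base_lt.
rewrite /param_act Pb permM /fibre_part ffunE.
case: ifP => [lt_c|/negbT]; rewrite ?perm1.
  by rewrite base_id //; case: (hhP a.2) => _; apply; left.
rewrite -leqNgt => le_c; rewrite ltnNge le_c /=; case: ifP => lt_c;
  rewrite ?perm1.
  case: (hhP (base a.2)) => _; apply; right.
  by apply: second_turn; rewrite le_c.
have [_ [_ <-]] := nnP a.2; last exact: chi_label.
by rewrite kap_iot -surjective_pairing.
Qed.

Lemma card_arc_stab : #|arc_stab i x| = #|family param_set|.
Proof.
rewrite -(card_in_imset param_to_perm_inj); apply: eq_card => g.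
apply/idP/imsetP=> [/param_to_perm_onto[P famP <-]|[P famP ->]].
  by exists P.
by have [g' Gg' /param_to_perm_eq->] := param_perm famP.
Qed.

End ArcStabiliser.

(** * Counting the parameters *)

Lemma card_point_stab w w' : #|'C_L[w | 'P]%g| = #|'C_L[w' | 'P]%g|.
Proof.
have orbT v : orbit 'P L v = setT.
  apply/setP=> v'; rewrite inE; have [h Lh <-] := transL v v'.
  by apply/imsetP; exists h.
have Omega_gt0 : (0 < #|[set: Omega]|)%N by rewrite cardsT; apply/card_gt0P;
  exists w.
apply/eqP; rewrite -(eqn_pmul2l Omega_gt0) -{1}(orbT w) -(orbT w').
by rewrite !card_orbit_stab.
Qed.

(** An element of [L] taking some point to the other block exchanges the blocks, and conjugation by
    it embeds either pointwise stabiliser into the other. *)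
Lemma card_block_stab b b' :
  #|'C_L([set w | chi w != b] | 'P)%g| = #|'C_L([set w | chi w != b'] | 'P)%g|.
Proof.
have le_card b1 : (#|'C_L([set w | chi w != b1] | 'P)%g| <=
                   #|'C_L([set w | chi w != ~~ b1] | 'P)%g|)%N.
  have [w0 _|L0] := pickP Omega; last first.
    apply: subset_leq_card; apply/subsetP=> h /setIP[Lh _]; rewrite inE Lh.
    by apply/astabP=> w; have := L0 w.
  have [h Lh hw0] := transL w0 (iot (kap w0) (~~ chi w0)).
  have h_chi w : chi (h w) = ~~ chi w.
    have := chiL w w0 Lh; rewrite hw0 chi_iot.
    by do 3!case: (chi _).
  rewrite -(card_imset _ (conjg_inj h)); apply: subset_leq_card.
  apply/subsetP=> _ /imsetP[y /setIP[Ly /astabP fix_y] ->].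
  rewrite inE groupJ //; apply/astabP=> w; rewrite inE => chi_w.
  rewrite /= apermE -{1}[w](permKV h) permJ.
  have -> : y ((h^-1)%g w) = (h^-1)%g w; last by rewrite permKV.
  apply: (fix_y ((h^-1)%g w)); rewrite inE; move: chi_w.
  by rewrite -{1}[w](permKV h) h_chi; case: (chi _) (b1) => [] [].
have [->//|neq_b] := eqVneq b b'.
have -> : b' = ~~ b by case: b b' neq_b => [] [].
by apply/eqP; rewrite eqn_leq le_card -{2}[b]negbK le_card.
Qed.

(** By offset there are [m] point-stabilisers, [m] trivial groups, and [2 l m - 2 m = 2 m (l - 1)]
    pointwise stabilisers of a block. *)
Lemma card_param_family i x omega :
  #|family (param_set i x)| =
  (#|'C_L([set w | chi w] | 'P)%g| ^ (2 * m * (l - 1)) *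
   #|'C_L[omega | 'P]%g| ^ m)%N.
Proof.
pose N1 := #|'C_L[omega | 'P]%g|; pose N2 := #|'C_L([set w | chi w] | 'P)%g|.
pose f u := if (u < m)%N then N1 else if (u < m.*2)%N then 1%N else N2.
have card_F c : #|param_set i x c| = f (offset i c).
  rewrite /param_set /f; case: ifP => _; first exact: card_point_stab.
  case: ifP => _; first by rewrite cards1.
  rewrite (card_block_stab _ false); congr #|'C_L(_ | 'P)%g|.
  by apply/setP=> w; rewrite !inE; case: (chi w).
rewrite card_family foldrE big_image /=.
under eq_bigr do rewrite card_F.
rewrite (reindex_inj (addrI i)) /=.
have offE (c : 'Z_r) : offset i (i + c) = val c by rewrite /offset addrC addKr.
under eq_bigr do rewrite offE.
rewrite -(big_mkord xpredT f) Zp_cast //.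
rewrite (@big_cat_nat _ _ _ m) //=; last by lia.
rewrite (@big_cat_nat _ _ _ m.*2 m) //=; last by lia.
rewrite (@eq_big_nat _ _ _ 0 m f (fun=> N1)); last first.
  by move=> u /andP[_ lt_u]; rewrite /f lt_u.
rewrite (@eq_big_nat _ _ _ m m.*2 f (fun=> 1%N)); last first.
  by move=> u /andP[le_u lt_u]; rewrite /f ltnNge le_u lt_u.
rewrite (@eq_big_nat _ _ _ m.*2 _ f (fun=> N2)); last first.
  by move=> u /andP[le_u _]; rewrite /f !ifF //; lia.
rewrite !prod_nat_const_nat exp1n mul1n subn0 mulnC; congr (_ ^ _ * _)%N.
nia.
Qed.

Lemma card_arc_stabE i x omega :
  #|arc_stab i x| =
  (#|'C_L([set w | chi w] | 'P)%g| ^ (2 * m * (l - 1)) *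
   #|'C_L[omega | 'P]%g| ^ m)%N.
Proof. by rewrite card_arc_stab (card_param_family _ _ omega). Qed.

(** * The action on C(k,r,s) *)

Section GraphAction.

Variables (Gam : sgraph) (code : Gam -> {set point}).
Hypothesis coding : segment_coding s code.

Let code_inj : injective code. Proof. by case: coding. Qed.
Let code_seg v : isseg s (code v). Proof. by case: coding. Qed.
Let code_onto S : isseg s S -> exists v, code v = S.
Proof. by case: coding => _ _ + _; apply. Qed.
Let adjE u v : adj u v <-> isseg s.+1 (code u :|: code v).
Proof. by case: coding. Qed.

(** The default is taken only for permutations of the points that do not permute the segments. *)
Definition graph_perm (g : {perm point}) : {perm Gam} :=
  odflt 1%g [pick q : {perm Gam} | [forall v, code (q v) == g @: code v]].

Lemma graph_permE g v : g \in twisted -> code (graph_perm g v) = g @: code v.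
Proof.
move=> Gg; have le_s : (s <= r)%N by lia.
have ex v' : exists u, code u == g @: code v'.
  have [u <-] := code_onto (isseg_imset s_gt0 le_s Gg (code_seg v')).
  by exists u.
have f_inj : injective (fun v' => xchoose (ex v')).
  move=> v1 v2 eq_v; apply: code_inj; apply: (imset_inj (@perm_inj _ g)).
  by rewrite -(eqP (xchooseP (ex v1))) eq_v (eqP (xchooseP (ex v2))).
rewrite /graph_perm; case: pickP => [q /forallP qP|/(_ (perm f_inj))] /=.
  exact/eqP.
by case/forallP=> v'; rewrite permE; apply: (xchooseP (ex v')).
Qed.

Lemma graph_permM :
  {in twisted &, {morph graph_perm : g h / (g * h)%g}}.
Proof.
move=> g h Gg Gh; apply/permP=> v; apply: code_inj.
rewrite permM !graph_permE ?groupM // -imset_comp.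
by apply: eq_imset => a; rewrite permM.
Qed.

Canonical graph_morphism := Morphism graph_permM.

Definition graph_group : {group {perm Gam}} := (graph_perm @* twisted)%G.

Lemma graph_permP q : reflect (exists2 g, g \in twisted & q = graph_perm g)
                              (q \in graph_group).
Proof.
apply: (iffP morphimP) => [[g Gg _ ->]|[g Gg ->]]; first by exists g.
by exists g.
Qed.

Lemma graph_perm_inj : ('injm graph_perm)%g.
Proof.
apply/subsetP=> g /morphpreP[Gg /set1P g1]; apply/set1P.
apply: twisted_faithful => S /code_onto[v <-].
by rewrite -graph_permE // g1 perm1.
Qed.

Lemma graph_perm_adj g u v : g \in twisted -> adj u v ->
  adj (graph_perm g u) (graph_perm g v).
Proof.
move=> Gg /adjE uv; apply/adjE; rewrite !graph_permE // -imsetU.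
by apply: isseg_imset => //; lia.
Qed.

Lemma graph_group_aut : graph_group \subset graph_aut Gam.
Proof.
apply/subsetP=> q /graph_permP[g Gg ->]; rewrite inE.
apply/forallP=> u; apply/forallP=> v; apply/eqP.
apply/idP/idP; last exact: graph_perm_adj.
move/(graph_perm_adj (groupVr Gg)).
by rewrite -!permM -graph_permM ?groupV // mulgV morph1 !perm1.
Qed.

Lemma arc_coding u v : adj u v -> exists (e : bool) i x,
  code (if e then v else u) = seg i x s /\
  code (if e then u else v) = seg (i + 1) (fun t => x t.+1) s.
Proof.
move/adjE/(seg_adjP r_gt2 s_gt0 le_sr (code_seg u) (code_seg v)).
by case=> e [i [x defs]]; exists e, i, x; case: e defs.
Qed.

Lemma graph_group_arc_transitive : arc_transitive graph_group.
Proof.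
move=> u v u' v' /arc_coding[e [i [x [def1 def2]]]].
case/arc_coding=> e' [i' [x' [def1' def2']]].
(* The element must reverse the columns exactly when the two arcs run in opposite directions. *)
pose b := e (+) e'; pose tau t := if b then (s - t)%N else t.
have [g Gg [_ gP]] :=
  (* The constant sends column [i + t] to [i' + tau t]. The coordinates are composed with [tau]
     because targets are indexed by source positions. *)
  twisted_move b (if b then i' + s%:R + i else i' - i) i x (x' \o tau).
have {}gP t : (t <= s)%N -> g (x t, i + t%:R) = (x' (tau t), i' + (tau t)%:R).
  move=> le_t; rewrite gP //; congr (_, _); rewrite /dih /tau.
  case: (b); last by rewrite addrA subrK.
  by rewrite natrB // opprD addrA addrK addrA.
have shift (j : 'Z_r) t : j + 1 + t%:R = j + t.+1%:R by rewrite -addrA nat1r.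
have le_s : (s <= r)%N by lia.
have im1 : g @: seg i x s =
    if b then seg (i' + 1) (fun t => x' t.+1) s else seg i' x' s.
  move: gP; rewrite /tau; case: (b) => /= {}gP; last first.
    by apply: (imset_seg (tau := id)) => // t lt_t; rewrite gP // ltnW.
  apply: (imset_seg (tau := fun t => (s - t).-1)) => // t lt_t.
  by split; [lia | rewrite (gP t (ltnW lt_t)) shift prednK ?subn_gt0].
have im2 : g @: seg (i + 1) (fun t => x t.+1) s =
    if b then seg i' x' s else seg (i' + 1) (fun t => x' t.+1) s.
  move: gP; rewrite /tau; case: (b) => /= {}gP; last first.
    by apply: (imset_seg (tau := id)) => // t lt_t; rewrite !shift gP.
  apply: (imset_seg (tau := fun t => (s - t.+1)%N)) => // t lt_t.
  by split; [lia | rewrite shift gP].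
exists (graph_perm g); first by apply/graph_permP; exists g.
move: im1 im2; rewrite -def1 -def2 -def1' -def2' /b => im1 im2.
clear def1 def2 def1' def2' b tau gP.
by case: e e' im1 im2 => [] [] /= im1 im2; congr (_, _);
  apply: code_inj; rewrite graph_permE.
Qed.

(** * The neighbours of a vertex and the local action *)

Section Neighbours.

Variables (v : Gam) (i : 'Z_r) (x : nat -> 'I_k).
Hypothesis def_v : code v = seg i x s.

Definition side (b : bool) : 'Z_r := if b then i - 1 else i - 1 + m%:R.

(** The segment shifted by one column, [z] being the coordinate of the new point: it lies in column
    [i - 1] if [b] holds, otherwise in [i + s = i - 1 + m]. *)
Definition nb_seg (b : bool) (z : 'I_k) : {set point} :=
  if b then seg (i - 1) (fun u => if u is u'.+1 then x u' else z) s
  else seg (i + 1) (fun u => if (u < s.-1)%N then x u.+1 else z) s.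

Lemma nb_segP u : adj v u <-> exists b z, code u = nb_seg b z.
Proof.
split.
  move/adjE/(seg_adjP r_gt2 s_gt0 le_sr (code_seg v) (code_seg u)).
  case=> -[] [j [y []]]; rewrite def_v.
    move=> def_u /(seg_inj r_gt2 s_gt0 le_sr)[def_i eq_xy].
    exists true, (y 0); rewrite def_u /nb_seg def_i addrK.
    by apply: eq_seg => -[|t] lt_t //; rewrite eq_xy // ltnW.
  move=> /(seg_inj r_gt2 s_gt0 le_sr)[def_i eq_xy] ->.
  exists false, (y s); rewrite /nb_seg def_i; apply: eq_seg => t lt_t.
  by case: ifP => lt_t1; [rewrite eq_xy //; lia | congr y; lia].
case=> -[] [z def_u]; apply/adjE.
  apply/(seg_adjP r_gt2 s_gt0 le_sr (code_seg v) (code_seg u)).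
  exists true, (i - 1), (fun u => if u is u'.+1 then x u' else z).
  by rewrite subrK.
apply/(seg_adjP r_gt2 s_gt0 le_sr (code_seg v) (code_seg u)).
exists false, i, (fun u => if (u < s)%N then x u else z); rewrite def_v def_u.
split; apply: eq_seg => t lt_t; first by rewrite lt_t.
by rewrite (_ : (t.+1 < s)%N = (t < s.-1)%N) //; lia.
Qed.

(** A neighbour covers just one of the flanking columns, so its new point identifies it with a point
    of [Omega]. *)
Lemma mem_nb_seg b z a : a.2 = i - 1 \/ a.2 = i - 1 + m%:R ->
  (a \in nb_seg b z) = (a == (z, side b)).
Proof.
have shift t : i + 1 + t%:R = i - 1 + t.+2%:R :> 'Z_r.
  by rewrite -[t.+2]add2n natrD addrA; congr (_ + _);
    rewrite mulr2n addrA subrK.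
move=> ca; apply/idP/eqP=> [|->]; rewrite /nb_seg /side; case: b.
- case/segP=> t lt_t def_a; rewrite def_a.
  have -> : t = 0; last by rewrite addr0.
  case: ca; rewrite def_a /=; last by move/addrI/(natr_Zp_inj r_gt2); lia.
  move/eqP; rewrite -subr_eq0 addrAC subrr add0r => /eqP.
  by move/(@natr_Zp_inj r r_gt2 _ 0); lia.
- case/segP=> t lt_t def_a; rewrite def_a.
  have -> : t = s.-1; last first.
    by rewrite ltnn shift (_ : s.-1.+2 = m) //; lia.
  case: ca; rewrite def_a [_.2]shift; last by move/addrI/(natr_Zp_inj r_gt2); lia.
  move/eqP; rewrite -subr_eq0 addrAC subrr add0r => /eqP.
  by move/(@natr_Zp_inj r r_gt2 _ 0); lia.
- by apply/segP; exists 0; rewrite ?addr0.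
apply/segP; exists s.-1; first by lia.
by rewrite ltnn shift (_ : s.-1.+2 = m) //; lia.
Qed.

Definition nb_side (w : Omega) : bool := chi w == colour (i - 1).

(** The inverse of [label] on the two flanking columns. *)
Definition nb_point (w : Omega) : point := (kap w, side (nb_side w)).

Lemma nb_point_column w :
  (nb_point w).2 = i - 1 \/ (nb_point w).2 = i - 1 + m%:R.
Proof. by rewrite /= /side; case: nb_side; [left | right]. Qed.

Lemma label_nb_point w : label (nb_point w) = w.
Proof.
apply: label_kap; rewrite /side /nb_side; case: eqP => // /eqP.
by rewrite colourDm; case: chi (colour _) => [] [].
Qed.

Lemma nb_exists w : exists u, code u == nb_seg (nb_side w) (kap w).
Proof.
have [|u <-] := code_onto (S := nb_seg (nb_side w) (kap w)); last by exists u.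
by rewrite /nb_seg; case: nb_side; do 2!eexists.
Qed.

Definition nb (w : Omega) : Gam := xchoose (nb_exists w).

Lemma code_nb w : code (nb w) = nb_seg (nb_side w) (kap w).
Proof. exact/eqP/(xchooseP (nb_exists w)). Qed.

Lemma adj_nb w : adj v (nb w).
Proof. by apply/nb_segP; exists (nb_side w), (kap w); apply: code_nb. Qed.

Lemma nb_point_in w : nb_point w \in code (nb w).
Proof. by rewrite code_nb mem_nb_seg //; apply: nb_point_column. Qed.

Lemma nb_unique u w : adj v u -> nb_point w \in code u -> u = nb w.
Proof.
case/nb_segP=> b [z def_u]; rewrite def_u mem_nb_seg;
  last exact: nb_point_column.
case/eqP/pair_equal_spec=> def_z eq_side; apply: code_inj.
rewrite code_nb def_u -def_z; congr nb_seg; symmetry.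
(* The two sides have different colours, so equal sides have equal booleans. *)
have colour_side b' : colour (side b') = b' (+) ~~ colour (i - 1).
  by rewrite /side; case: b'; rewrite ?colourDm /= ?negbK.
have := congr1 colour eq_side; rewrite !colour_side.
by case: (nb_side w) (b) (colour (i - 1)) => [] [] [].
Qed.

Lemma nb_inj : injective nb.
Proof.
move=> w w' eq_nb; have := nb_point_in w; rewrite eq_nb code_nb mem_nb_seg.
  by move/eqP/(congr1 label); rewrite !label_nb_point.
exact: nb_point_column.
Qed.

Lemma nb_onto u : adj v u -> exists w, nb w = u.
Proof.
move=> vu; have /nb_segP[b [z def_u]] := vu.
exists (label (z, side b)); symmetry; apply: nb_unique => //.
have cb : (z, side b).2 = i - 1 \/ (z, side b).2 = i - 1 + m%:R.
  by rewrite /side; case: (b); [left | right].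
rewrite (@label_inj2 (i - 1) (nb_point _) (z, side b)) ?label_nb_point //;
  last first.
  exact: nb_point_column.
by rewrite def_u mem_nb_seg.
Qed.

(** The image under [g] of the point of label [w] is the flanking point of label [h w], and it
    determines the neighbour. *)
Lemma graph_perm_nb g h : g \in twisted -> graph_perm g v = v ->
  (forall a, a.2 = i - 1 \/ a.2 = i - 1 + m%:R ->
    ((g a).2 = i - 1 \/ (g a).2 = i - 1 + m%:R) /\ label (g a) = h (label a)) ->
  forall w, graph_perm g (nb w) = nb (h w).
Proof.
move=> Gg fix_v gP w; apply: nb_unique.
  by rewrite -{1}fix_v; apply: graph_perm_adj => //; apply: adj_nb.
have [col_g lab_g] := gP _ (nb_point_column w).
rewrite (@label_inj2 (i - 1) (nb_point _) (g (nb_point w))) //.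
- by rewrite graph_permE // imset_f // nb_point_in.
- exact: nb_point_column.
by rewrite lab_g !label_nb_point.
Qed.

Lemma local_group_isom : perm_isomorphic L (local_group graph_group v).
Proof.
apply: (@perm_isomorphic_induced _ _ _ _ _ nb).
- exact: nb_inj.
- by move=> w; rewrite inE adj_nb.
- by move=> u; rewrite inE => /nb_onto[w <-]; exists w.
- move=> q /setIP[/graph_permP[g Gg ->] /astab1P]; rewrite /= apermE => fix_v.
  have stab_g : g @: seg i x s = seg i x s by rewrite -def_v -graph_permE
    ?fix_v.
  have [h Lh hP] := twisted_stab_local Gg stab_g.
  by exists h => //; apply: graph_perm_nb.
move=> h Lh; have [g Gg [stab_g hP]] := twisted_realise i x Lh.
have fix_v : graph_perm g v = v.
  by apply: code_inj; rewrite graph_permE // def_v.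
exists (graph_perm g); last exact: graph_perm_nb.
rewrite inE; apply/andP; split; first by apply/graph_permP; exists g.
by apply/astab1P.
Qed.

End Neighbours.

Lemma graph_group_locally : locally L graph_group.
Proof.
split; first exact: graph_group_aut; first exact: graph_group_arc_transitive.
by move=> v; have [i [x def_v]] := code_seg v; apply: (local_group_isom def_v).
Qed.

(** The injective map [graph_perm] carries [arc_stab] onto the stabiliser of the arc, whichever end
    comes first as a segment. *)
Lemma card_graph_arc_stab u v omega : adj u v ->
  #|('C_graph_group[u | 'P] :&: 'C_graph_group[v | 'P])%g| =
  (#|'C_L([set w | chi w] | 'P)%g| ^ (2 * m * (l - 1)) *
   #|'C_L[omega | 'P]%g| ^ m)%N.
Proof.
move/arc_coding=> [e [i [x [def1 def2]]]].
rewrite -(card_arc_stabE i x omega).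
rewrite -(card_injm graph_perm_inj (A := arc_stab i x)); last first.
  by apply/subsetP=> g /setIdP[].
apply: eq_card => q.
have fixE g y : g \in twisted ->
    (graph_perm g \in 'C[y | 'P]%g) = (g @: code y == code y).
  move=> Gg; rewrite -graph_permE // (inj_eq code_inj).
  by apply/astab1P/eqP.
apply/idP/morphimP.
  case/setIP=> /setIP[/graph_permP[g Gg ->] fix_u] /setIP[_ fix_v].
  exists g => //; rewrite inE Gg -def1 -def2.
  by rewrite !fixE // in fix_u fix_v; case: (e); rewrite fix_u fix_v.
case=> g Gg /setIdP[_]; rewrite -def1 -def2 => /andP[fix1 fix2] ->.
have Gq : graph_perm g \in graph_group by apply/graph_permP; exists g.
have [fix_u fix_v] : g @: code u == code u /\ g @: code v == code v.
  by case: (e) fix1 fix2.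
by apply/setIP; split; apply/setIP; rewrite fixE.
Qed.

End GraphAction.

End TwistedGroup.

Lemma Cgraph_coding k r s : (0 < s)%N -> (2 < r)%N -> (s.*2 <= r)%N ->
  exists code : Cgraph k r s -> {set 'I_k * 'Z_r}, segment_coding s code.
Proof.
case: s => [|[|n]] // _ r_gt2 le_sr.
  by exists (fun a => [set a]); apply: C1_coding.
by exists (fun H => (val H).1); apply: trav_graph_coding.
Qed.

(** * Permutation groups with two blocks *)

Lemma block_enum (T : finType) (S : {set T}) k : #|S| = k -> (0 < k)%N ->
  exists (f : 'I_k -> T) (g : T -> 'I_k),
    [/\ forall x, f x \in S, cancel f g & {in S, cancel g f}].
Proof.
move=> <- /card_gt0P[y0 Sy0]; exists (@enum_val _ (mem S)), (enum_rank_in Sy0).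
split; [exact: enum_valP | exact: enum_valK_in | exact: enum_rankK_in].
Qed.

Section TwoBlocks.

Variables (T : finType) (L : {group {perm T}}) (A B : {set T}).
Hypotheses (neqAB : A != B) (blocksAB : block_system L [set A; B]).

Lemma two_blocks_compl : B = ~: A.
Proof.
case/andP: blocksAB => /and3P[/eqP covAB /trivIsetP trivAB _] _.
have /trivAB disAB : A \in [set A; B] by rewrite !inE eqxx.
have {}disAB : [disjoint A & B] by apply: disAB; rewrite ?inE ?eqxx ?orbT.
apply/setP=> w; rewrite inE; apply/idP/idP => [Bw|notAw].
  by apply: contraL Bw => /(disjointFr disAB)->.
have : w \in cover [set A; B] by rewrite covAB inE.
by case/bigcupP=> C /set2P[] -> //; rewrite (negPf notAw).
Qed.

Lemma two_blocks_image h : h \in L -> h @: A = A \/ h @: A = B.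
Proof.
case/andP: blocksAB => _ actsAB Lh.
have /set2P : ('P^* A h)%act \in [set A; B].
  by rewrite (acts_act actsAB) // !inE eqxx.
by case=> eq_hA; [left | right]; rewrite -[RHS]eq_hA; apply: eq_imset.
Qed.

(** Either [h] preserves [A] or it exchanges [A] with its complement. *)
Lemma two_blocks_invariant h w w' : h \in L ->
  ((h w \in A) == (h w' \in A)) = ((w \in A) == (w' \in A)).
Proof.
move=> Lh; have memA v : (h v \in h @: A) = (v \in A).
  by rewrite mem_imset //; apply: perm_inj.
have [eq_hA|eq_hA] := two_blocks_image Lh; rewrite eq_hA in memA.
  by rewrite !memA.
have memN v : (v \in A) = (h v \notin A).
  by rewrite -memA two_blocks_compl inE.
by rewrite (memN w) (memN w'); do 2!case: (h _ \in A).
Qed.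

(** An element of [L] taking a point of [A] into [B] maps [A] onto [B]. *)
Lemma two_blocks_card : [transitive L, on [set: T] | 'P] -> #|A| = #|B|.
Proof.
move=> transL.
have nonempty C : C \in [set A; B] -> exists w, w \in C.
  case/andP: blocksAB => /and3P[_ _ notin0] _ PC; apply/set0Pn.
  by apply: contraNneq notin0 => <-.
have [a Aa] : exists w, w \in A by apply: nonempty; rewrite !inE eqxx.
have [b Bb] : exists w, w \in B by apply: nonempty; rewrite !inE eqxx orbT.
have [h Lh def_b] := atransP2 transL (in_setT a) (in_setT b).
have [eq_hA|<-] := two_blocks_image Lh; last by rewrite card_imset //;
  apply: perm_inj.
have Ab : b \in A by rewrite -eq_hA def_b; apply: imset_f.
by move: Bb; rewrite {1}two_blocks_compl inE Ab.
Qed.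

End TwoBlocks.

Close Scope ring_scope.

Theorem theorem4p1 (k : nat) (Omega : finType) (L : {group {perm Omega}})
    (A B : {set Omega}) (omega : Omega) (l m : nat)
    (degL : #|Omega| = (2 * k)%N)
    (transL : [transitive L, on [set: Omega] | 'P])
    (neqAB : A != B)
    (blocksAB : block_system L [set A; B])
    (l_ge1 : 1 <= l) (m_ge2 : 2 <= m)
    (u v : Cgraph k (2 * l * m) (m - 1))
    (arc_uv : adj u v) :
  exists G : {group {perm Cgraph k (2 * l * m) (m - 1)}},
    locally L G /\
    #|('C_G[u | 'P] :&: 'C_G[v | 'P])%g| =
      (#|'C_L(A | 'P)%g| ^ (2 * m * (l - 1)) * #|'C_L[omega | 'P]%g| ^ m)%N.
Proof.
case: m m_ge2 u v arc_uv => [//|s]; rewrite ltnS subSS subn0 =>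
  s_gt0 u v arc_uv.
have defB := two_blocks_compl neqAB blocksAB.
have cardAB := two_blocks_card neqAB blocksAB transL.
have cardA : #|A| = k by have := cardsC A; rewrite -defB degL; lia.
have k_gt0 : 0 < k by have := max_card (pred1 omega); rewrite card1 degL; lia.
have [fA [gA [fAP fAK gAK]]] := block_enum cardA k_gt0.
have [fB [gB [fBP fBK gBK]]] := block_enum (etrans (esym cardAB) cardA) k_gt0.
(* The blocks are [A] for [true] and [B] for [false], each enumerated by ['I_k]. *)
pose chi w := w \in A.
pose kap w := if w \in A then gA w else gB w.
pose iot x b := if b then fA x else fB x.
have fB_notA x : (fB x \in A) = false.
  by have := fBP x; rewrite defB inE => /negPf.
have iot_kap w : iot (kap w) (chi w) = w.
  rewrite /iot /kap /chi; case Aw: (w \in A); first exact: gAK.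
  by apply: gBK; rewrite defB inE Aw.
have kap_iot x b : kap (iot x b) = x.
  by rewrite /kap /iot; case: b; rewrite ?fAP ?fB_notA.
have chi_iot x b : chi (iot x b) = b.
  by rewrite /chi /iot; case: b; rewrite ?fAP ?fB_notA.
have chiL h w w' : h \in L -> (chi (h w) == chi (h w')) = (chi w == chi w').
  exact: (two_blocks_invariant neqAB blocksAB).
have transLP w w' : exists2 h, h \in L & h w = w'.
  by have [h Lh ->] := atransP2 transL (in_setT w) (in_setT w'); exists h.
have [|||code coding] := @Cgraph_coding k (2 * l * s.+1) s; try by nia.
have defA : [set w | chi w] = A by apply/setP=> w; rewrite inE.
exists (graph_group L l_ge1 s_gt0 iot coding); split.
  exact: (graph_group_locally _ _ iot_kap kap_iot chi_iot chiL transLP).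
rewrite (card_graph_arc_stab _ _ iot_kap kap_iot chi_iot chiL transLP _ omega) //.
by rewrite defA.
Qed.
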